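(* For every integer $n\ge 1$, the number of (isomorphism classes of) rooted bridgeless combinatorial maps of size $n$ is equal to the number of (isomorphism classes of) rooted connected chord diagrams of size $n$.
   Context: A rooted chord diagram of size $n$ is (up to isomorphism) a perfect matching of the linearly ordered set $\{0<1<\dots<2n-1\}$ into $n$ pairs $(a,b)$ with $a<b$, called chords; the root chord is the chord containing $0$. Two chords $(a,b)$ and $(c,d)$ cross if $a<c<b<d$ or $c<a<d<b$. A diagram is connected if the graph whose vertices are the chords and whose edges join crossing chords is connected. A rooted combinatorial map is a quadruple $(H,\sigma,\alpha,r)$ where $H$ is a finite set of half-edges, $\sigma$ is a permutation of $H$, $\alpha$ is an involution of $H$, $r\in H$ satisfies $\alpha(r)=r$, and the group generated by $\sigma,\alpha$ acts transitively on $H$; isomorphisms are bijections commuting with $\sigma,\alpha$ and preserving $r$. Here maps are closed: $r$ is the only fixed point of $\alpha$. The underlying graph has the $\sigma$-orbits as vertices and the $\alpha$-orbits as edges (the orbit $\{r\}$ is a dangling edge, the root), an edge being incident to the vertices it meets. The size of a map is the number of $\alpha$-orbits (the root counts as an edge), so the map with a single half-edge has size $1$. A map is bridgeless if its underlying graph has no edge whose deletion disconnects it. *)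

(* Defs.v *)
From mathcomp Require Import all_boot all_fingroup.
Set Implicit Arguments. Unset Strict Implicit. Unset Printing Implicit Defensive.

Section Chords.
Variable m : nat.
Local Notation T := 'I_m.

Definition perfect_matching (P : {set {set T}}) : bool :=
  partition P [set: T] && [forall C in P, #|C| == 2].

Definition chords_cross (C D : {set T}) : bool :=
  [exists a : T, exists b : T, exists c : T, exists d : T,
     [&& C == [set a; b], D == [set c; d] &
        ((a < c < b) && (b < d)) || ((c < a < d) && (d < b))]].

Definition cross_rel (P : {set {set T}}) : rel {set T} :=
  fun C D => [&& C \in P, D \in P & chords_cross C D].

Definition diagram_connected (P : {set {set T}}) : bool :=
  [forall C in P, forall D in P, connect (cross_rel P) C D].
End Chords.

(* Connected chord diagrams of size n: perfect matchings of 'I_(2n).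
   (Isomorphisms of chord diagrams are order-preserving bijections of the
   linearly ordered ground set, hence identities, so isomorphism classes
   are exactly the matchings themselves.) *)
Definition connected_diagrams (n : nat) : {set {set {set 'I_(n.*2)}}} :=
  [set P | perfect_matching P && diagram_connected P].

Section Maps.
Variable k : nat.
Local Notation T := 'I_k.

(* a map on half-edge set T: (sigma, alpha, root) *)
Definition rmap := ({perm T} * {perm T} * T)%type.

Definition msigma (M : rmap) : {perm T} := M.1.1.
Definition malpha (M : rmap) : {perm T} := M.1.2.
Definition mroot (M : rmap) : T := M.2.

Definition is_closed_rmap (M : rmap) : bool :=
  [forall h : T, malpha M (malpha M h) == h] &&
  [forall h : T, (malpha M h == h) == (h == mroot M)] &&
  [forall h : T, orbit 'P%act <<[set msigma M; malpha M]>>%g h == [set: T]].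

Definition rmap_iso (M M' : rmap) : bool :=
  [exists f : {perm T},
     [forall h : T, f (msigma M h) == msigma M' (f h)] &&
     [forall h : T, f (malpha M h) == malpha M' (f h)] &&
     (f (mroot M) == mroot M')].

Definition mvertex (M : rmap) (h : T) : {set T} := porbit (msigma M) h.
Definition medge (M : rmap) (h : T) : {set T} := porbit (malpha M) h.
Definition medges (M : rmap) : {set {set T}} := [set medge M h | h : T].
Definition mvertices (M : rmap) : {set {set T}} := [set mvertex M h | h : T].

Definition adj_minus (M : rmap) (e : {set T}) : rel {set T} :=
  fun u v => [exists h : T,
     [&& u == mvertex M h, v == mvertex M (malpha M h) & medge M h != e]].

Definition is_bridge (M : rmap) (e : {set T}) : bool :=
  (e \in medges M) &&
  ~~ [forall u in mvertices M, forall v in mvertices M,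
        connect (adj_minus M e) u v].

Definition bridgeless (M : rmap) : bool :=
  [forall e in medges M, ~~ is_bridge M e].

Definition bridgeless_maps : {set rmap} :=
  [set M | is_closed_rmap M && bridgeless M].

Definition num_bridgeless_classes : nat :=
  #|equivalence_partition rmap_iso bridgeless_maps|.
End Maps.

(* Main.v *)
Require Import Defs.
From mathcomp Require Import all_boot all_fingroup zify.
Set Implicit Arguments. Unset Strict Implicit. Unset Printing Implicit Defensive.

(* Write c_n for the number of connected diagrams and b_n for the number of
   bridgeless maps of size n.  Both satisfy x_1 = 1 and
   x_n = \sum_(1 <= k < n) (2k - 1) x_k x_(n-k).
   - Diagrams: delete the root chord and take the component of the next
     endpoint.  It has some size k, and everything else sits in one of its
     2k - 1 inner gaps and forms, with the root chord, a connected diagram of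
     size n - k.
   - Maps: let h follow the root r in its vertex.  Detaching h from that vertex
     leaves a chain of bridgeless maps joined by bridges, starting at r and
     ending at h.  The first one has size k, its bridge leaves from one of 2k - 1
     corners, and the rest of the chain is closed up into a bridgeless map by
     reattaching h next to the other end of that bridge.
   Maps are counted with labelled half-edges; as rooted maps are rigid, there
   are (2n - 1)! labellings of each.  Connectivity is expressed throughout by
   sets that are stable under the allowed moves. *)

(** * Stable sets and extension of permutations *)

(** A bridgeless map offers no bridge to cut. Detaching [h] creates them: the edge of [h] is not a
    bridge, so the detached map is still connected, and each of its bridges separates [r] from [h],
    since otherwise it would already be a bridge of the map. So the bridges are linearly ordered on
    the way from [r] to [h], and the first piece is the smallest set that one of them cuts off.
    Labels avoid gluing up to isomorphism: the pieces are permutations with disjoint supports in one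
    set, combined by their product. Products act from left to right, so [tperm u v * s] swaps the
    successors of [u] and [v]; all surgery is such a multiplication and is undone by repeating it.
    The coefficient 2k - 1 is the number of corners of a map with 2k - 1 half-edges, and the number
    of inner gaps between 2k points. Indexed this way the two recurrences agree term by term, the
    labels contributing 'C(N, j) * (N - j) * j! * (N - 1 - j)! = N!. *)

Definition stable (T : finType) (s : {perm T}) (A : {set T}) :=
  [forall y, (s y \in A) == (y \in A)].

Lemma stableP (T : finType) (s : {perm T}) (A : {set T}) :
  reflect (forall y, (s y \in A) = (y \in A)) (stable s A).
Proof. by apply: (iffP forallP) => sA y; have /eqP := sA y; rewrite ?sA. Qed.

(** Swapping the successors of two points on the same side of [A] is harmless; this carries stable
    sets through all the surgery below. *)
Lemma stable_tperm (T : finType) (s : {perm T}) (A : {set T}) u v :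
  (u \in A) = (v \in A) -> stable s A -> stable (tperm u v * s)%g A.
Proof.
move=> uv /stableP sA; apply/stableP => y; rewrite permM sA.
by case: tpermP => [->|->|//].
Qed.

Lemma stable_inv (T : finType) (s : {perm T}) (A : {set T}) :
  (forall y, s (s y) = y) -> (forall y, y \in A -> s y \in A) -> stable s A.
Proof.
move=> sK sA; apply/stableP => y; apply/idP/idP => [/sA|/sA //]; by rewrite sK.
Qed.

Lemma stableC (T : finType) (s : {perm T}) (A : {set T}) :
  stable s A -> stable s (~: A).
Proof. by move/stableP=> sA; apply/stableP => y; rewrite !inE sA. Qed.

Lemma perm_on_stable (T : finType) (s : {perm T}) (A : {set T}) :
  perm_on A s -> stable s A.
Proof. by move=> onA; apply/stableP => y; rewrite perm_closed. Qed.

Lemma permMl (T : finType) (A B : {set T}) (s t : {perm T}) y :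
  perm_on A s -> perm_on B t -> [disjoint A & B] -> y \notin B ->
  (s * t)%g y = s y.
Proof.
move=> sA tB dAB yB; rewrite permM (out_perm tB) //.
have [yA|yA] := boolP (y \in A); last by rewrite (out_perm sA).
by rewrite (disjointFr dAB) ?perm_closed.
Qed.

Lemma permMr (T : finType) (A : {set T}) (s t : {perm T}) y :
  perm_on A s -> y \notin A -> (s * t)%g y = t y.
Proof. by move=> sA yA; rewrite permM (out_perm sA). Qed.

Lemma restr_permP (T : finType) (s : {perm T}) (A : {set T}) y :
  stable s A -> restr_perm A s y = if y \in A then s y else y.
Proof.
move/stableP=> sA; case: ifP => yA; last first.
  by rewrite (out_perm (restr_perm_on A s)) ?yA.
apply: restr_permE => //; apply/astabsP => z; exact: sA.
Qed.

Lemma stableM (T : finType) (s t : {perm T}) (A : {set T}) :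
  stable s A -> stable t A -> stable (s * t)%g A.
Proof.
by move=> /stableP sA /stableP tA; apply/stableP => y; rewrite permM tA sA.
Qed.

Lemma stableU (T : finType) (s : {perm T}) (A B : {set T}) :
  stable s A -> stable s B -> stable s (A :|: B).
Proof. by move=> /stableP sA /stableP sB; apply/stableP => y; rewrite !inE sA sB. Qed.

Lemma stableI (T : finType) (s : {perm T}) (A B : {set T}) :
  stable s A -> stable s B -> stable s (A :&: B).
Proof. by move=> /stableP sA /stableP sB; apply/stableP => y; rewrite !inE sA sB. Qed.

Lemma tpermKg (T : finType) (u v : T) (s : {perm T}) :
  (tperm u v * (tperm u v * s))%g = s.
Proof. by rewrite mulgA tperm2 mul1g. Qed.

Lemma stable_restrI (T : finType) (s : {perm T}) (A H : {set T}) :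
  stable s H -> stable (restr_perm H s) A -> stable s (A :&: H).
Proof.
move=> sH /stableP sA; apply/stableP => y; rewrite !inE (stableP _ _ sH).
have [yH|] := boolP (y \in H); last by rewrite !andbF.
by rewrite !andbT -[in RHS]sA restr_permP // yH.
Qed.

Lemma perm_on_mul_inj (T : finType) (A B : {set T}) (s t u v : {perm T}) :
  [disjoint A & B] -> perm_on A s -> perm_on B t -> perm_on A u -> perm_on B v ->
  (s * t = u * v)%g -> s = u /\ t = v.
Proof.
move=> D sA tB uA vB E; suff su : s = u by split=> //; apply: (mulgI u); rewrite -E su.
apply/permP => y; have [yA|yA] := boolP (y \in A); last by rewrite (out_perm sA) ?(out_perm uA).
have yB : y \notin B by rewrite (disjointFr D).
by rewrite -(permMl sA tB D yB) -(permMl uA vB D yB) E.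
Qed.

(** Cuts a permutation into the two pieces needed in [glue_surj]; the fixed point [x] lies in
    neither support. *)
Lemma restr_permM (T : finType) (s : {perm T}) (V : {set T}) x :
  stable s V -> x \in V -> s x = x ->
  (restr_perm (V :\ x) s * restr_perm (~: V) s)%g = s.
Proof.
move=> sV xV sx.
have sH : stable s (V :\ x).
  by apply/stableP => y; rewrite !inE (stableP _ _ sV) -{1}sx (inj_eq perm_inj).
apply/permP => y; rewrite permM !restr_permP ?stableC //.
rewrite !inE; have [->|yx] := eqVneq y x; first by rewrite /= xV sx.
by case: (boolP (y \in V)) => yV /=; rewrite ?(stableP _ _ sV) yV.
Qed.

(** The default [t] makes the transported permutation the identity off the image of [f], as the
    [perm_on] conditions on labelled objects demand. *)
Definition ext_fun (S T : finType) (f : S -> T) (s : {perm S}) (t : T) : T :=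
  if [pick x | f x == t] is Some x then f (s x) else t.

Lemma ext_funE (S T : finType) (f : S -> T) (s : {perm S}) x :
  injective f -> ext_fun f s (f x) = f (s x).
Proof.
move=> fI; rewrite /ext_fun; case: pickP => [z /eqP/fI -> //|/(_ x)].
by rewrite eqxx.
Qed.

Lemma ext_fun_out (S T : finType) (f : S -> T) (s : {perm S}) t :
  t \notin f @: setT -> ext_fun f s t = t.
Proof.
rewrite /ext_fun; case: pickP => [z /eqP <-|//].
by rewrite imset_f ?inE.
Qed.

Lemma ext_fun_inj (S T : finType) (f : S -> T) (s : {perm S}) :
  injective f -> injective (ext_fun f s).
Proof.
move=> fI t u.
have [/imsetP[x _ ->]|tf] := boolP (t \in f @: setT);
have [/imsetP[y _ ->]|uf] := boolP (u \in f @: setT).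
- by rewrite !ext_funE // => /fI/perm_inj->.
- by rewrite ext_funE // ext_fun_out // => E; rewrite -E imset_f ?inE in uf.
- by rewrite ext_fun_out // ext_funE // => E; rewrite E imset_f ?inE in tf.
- by rewrite !ext_fun_out.
Qed.

Definition ext_perm (S T : finType) (f : S -> T) (fI : injective f)
  (s : {perm S}) : {perm T} := perm (@ext_fun_inj S T f s fI).

Lemma ext_permE (S T : finType) (f : S -> T) (fI : injective f) s x :
  ext_perm fI s (f x) = f (s x).
Proof. by rewrite permE ext_funE. Qed.

Lemma ext_perm_out (S T : finType) (f : S -> T) (fI : injective f) s t :
  t \notin f @: setT -> ext_perm fI s t = t.
Proof. by move=> tf; rewrite permE ext_fun_out. Qed.

Lemma ext_perm_on (S T : finType) (f : S -> T) (fI : injective f) s :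
  perm_on (f @: setT) (ext_perm fI s).
Proof.
apply/subsetP => t; rewrite inE; apply: contraR => tf.
by rewrite ext_perm_out.
Qed.

Lemma ext_perm_inj (S T : finType) (f : S -> T) (fI : injective f) :
  injective (ext_perm fI).
Proof.
by move=> s t st; apply/permP => x; apply: (fI); rewrite -!(ext_permE fI) st.
Qed.

(** By counting: the extensions are supported on the image, and there are as many of them as
    permutations with that support. *)
Lemma ext_perm_surj (S T : finType) (f : S -> T) (fI : injective f) p :
  perm_on (f @: setT) p -> exists s, p = ext_perm fI s.
Proof.
move=> pf.
suff /setP/(_ p) : [set ext_perm fI s | s in setT] = [set q | perm_on (f @: setT) q].
  by rewrite [in RHS]inE pf => /imsetP[s _ ->]; exists s.
apply/eqP; rewrite eqEcard; apply/andP; split.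
  by apply/subsetP => _ /imsetP[s _ ->]; rewrite inE ext_perm_on.
rewrite card_imset; last exact: ext_perm_inj.
have -> : #|[set q | perm_on (f @: setT) q]| = #|perm_on (f @: setT)|.
  by apply: eq_card => q; rewrite inE.
rewrite card_perm card_imset //.
rewrite -(card_perm [set: S]).
by rewrite cardsT; apply: max_card.
Qed.

Lemma stable_ext_preim (S T : finType) (f : S -> T) (fI : injective f) s
  (A : {set T}) : stable (ext_perm fI s) A -> stable s (f @^-1: A).
Proof. by move/stableP=> sA; apply/stableP => y; rewrite !inE -[in RHS]sA ext_permE. Qed.

Lemma stable_ext_im (S T : finType) (f : S -> T) (fI : injective f) s
  (A : {set S}) : stable s A -> stable (ext_perm fI s) (f @: A).
Proof.
move/stableP=> sA; apply/stableP => y.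
have [/imsetP[x _ ->]|yf] := boolP (y \in f @: setT); last by rewrite ext_perm_out.
by rewrite ext_permE !mem_imset.
Qed.

(** * Labelled bridgeless maps *)

(** Only the edge of [x] may cross the border of [A]. It is a bridge exactly when some such [A],
    also stable under the vertex permutation, is neither empty nor everything. *)
Definition edge_stable (T : finType) (a : {perm T}) (x : T) (A : {set T}) :=
  [forall y, (y \in [set x; a x]) || ((a y \in A) == (y \in A))].

Lemma edge_stableP (T : finType) (a : {perm T}) x (A : {set T}) :
  reflect (forall y, y != x -> y != a x -> (a y \in A) = (y \in A))
    (edge_stable a x A).
Proof.
apply: (iffP forallP) => aA y.
  by move=> yx yax; have := aA y; rewrite !inE (negPf yx) (negPf yax) => /eqP.
by rewrite !inE; case: eqVneq => //= yx; case: eqVneq => //= yax; rewrite aA.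
Qed.

Lemma stable_edge (T : finType) (a : {perm T}) x (A : {set T}) :
  stable a A -> edge_stable a x A.
Proof. by move=> /stableP aA; apply/edge_stableP => y _ _. Qed.

Lemma edge_stableC (T : finType) (a : {perm T}) x (A : {set T}) :
  edge_stable a x A -> edge_stable a x (~: A).
Proof.
by move/edge_stableP=> aA; apply/edge_stableP => y yx yax; rewrite !inE aA.
Qed.

(* Labelled bridgeless maps with half-edge set [H]; the permutations are the
   identity outside [H].  Connectivity after deleting the edge of [x] is
   expressed by sets stable under the remaining moves; for [x = r] nothing is
   deleted. *)
Record bridgeless_on (T : finType) (H : {set T}) (s a : {perm T}) (r : T) :
  Prop := BridgelessOn {
  bsigma_on : perm_on H s;
  balpha_on : perm_on H a;
  broot_in : r \in H;
  balphaK : forall y, a (a y) = y;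
  balpha_fix : forall y, y \in H -> (a y == y) = (y == r);
  bconn : forall x (A : {set T}), x \in H -> stable s A -> edge_stable a x A ->
    r \in A -> H \subset A }.

Definition lmaps (T : finType) (H : {set T}) : {set {perm T} * {perm T} * T} :=
  [set M | [&& perm_on H M.1.1, perm_on H M.1.2, M.2 \in H,
    [forall y, M.1.2 (M.1.2 y) == y],
    [forall y in H, (M.1.2 y == y) == (y == M.2)] &
    [forall x in H, [forall A : {set T},
      stable M.1.1 A ==> edge_stable M.1.2 x A ==> (M.2 \in A) ==>
        (H \subset A)]]]].

Lemma lmapsP (T : finType) (H : {set T}) s a r :
  reflect (bridgeless_on H s a r) ((s, a, r) \in lmaps H).
Proof.
rewrite inE /=; apply: (iffP and5P).
  case=> sH aH rH /forallP aK /andP[/forall_inP afix /forall_inP conn]; split=> //.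
  - by move=> y; apply/eqP/aK.
  - by move=> y /afix/eqP.
  - by move=> x A /conn/forallP/(_ A)/implyP cA /cA/implyP dA /dA/implyP.
case=> sH aH rH aK afix conn; split=> //.
  by apply/forallP => y; rewrite aK.
apply/andP; split; first by apply/forall_inP => y /afix ->.
apply/forall_inP => x xH; apply/forallP => A.
by apply/implyP => ?; apply/implyP => ?; apply/implyP => ?; apply: conn xH _ _ _.
Qed.

Lemma broot_fix (T : finType) (H : {set T}) s a r :
  bridgeless_on H s a r -> a r = r.
Proof. by move=> B; apply/eqP; rewrite (balpha_fix B) ?eqxx ?(broot_in B). Qed.

Lemma bconn_full (T : finType) (H : {set T}) s a r (A : {set T}) :
  bridgeless_on H s a r -> stable s A -> stable a A -> r \in A -> H \subset A.
Proof.
by move=> B sA aA; apply: (bconn B (broot_in B) sA); apply: stable_edge.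
Qed.

(* Detaching the half-edge [s r] from the root vertex does not disconnect the
   map, because the edge of [s r] is not a bridge. *)
Lemma bdetach (T : finType) (H : {set T}) s a r (A : {set T}) :
  bridgeless_on H s a r -> stable (tperm r (s r) * s)%g A -> stable a A ->
  (s r \in A) = (r \in A).
Proof.
move=> B; set h := s r.
wlog rA : A / r \in A => [WL|] sA aA.
  have [rA|rA] := boolP (r \in A); first by rewrite WL.
  have := WL (~: A); rewrite !inE rA => /(_ isT) WC.
  have /negbTE-> // : h \notin A.
  by rewrite WC //; apply: stableC.
rewrite rA; apply/negPn/negP => hA.
have hr : h != r by apply: contraNneq hA => ->.
have hH : h \in H by rewrite perm_closed ?(bsigma_on B) ?(broot_in B).
have sK : (tperm r h * (tperm r h * s))%g = s by rewrite mulgA tperm2 mul1g.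
(* With [h] added, [A] is closed in the original map except across the edge of [h]. Hence it is
   everything, and [a h], not being in [A], would have to equal [h]. *)
have ss : stable s (h |: A).
  rewrite -sK; apply: stable_tperm; first by rewrite !inE eqxx rA orbT.
  apply/stableP => y; rewrite !inE (stableP _ _ sA); congr (_ || _).
  have E : (tperm r h * s)%g h = h by rewrite permM tpermR.
  apply/eqP/eqP => [Eh|-> //].
  by apply: (@perm_inj _ (tperm r h * s)%g); rewrite Eh E.
have es : edge_stable a h (h |: A).
  apply/edge_stableP => y yh yah; rewrite !inE (stableP _ _ aA) (negPf yh).
  by rewrite -(inj_eq (@perm_inj _ a)) (balphaK B) (negPf yah).
have /subsetP/(_ (a h)) := bconn B hH ss es (setU1r _ rA).
rewrite perm_closed ?(balpha_on B) // hH !inE (stableP _ _ aA) (negPf hA) orbF.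
by rewrite (balpha_fix B) // (negPf hr) => /(_ isT).
Qed.

Lemma lmaps_ext (S T : finType) (f : S -> T) (fI : injective f) :
  lmaps (f @: setT) =
  [set (ext_perm fI M.1.1, ext_perm fI M.1.2, f M.2) | M in lmaps [set: S]].
Proof.
apply/setP => -[[p q] t].
apply/lmapsP/imsetP => [B|[[[s a] r] /lmapsP B [-> -> ->]]]; last first.
  split; rewrite ?ext_perm_on ?imset_f ?inE //.
  - move=> y; have [/imsetP[x _ ->]|yf] := boolP (y \in f @: setT).
      by rewrite !ext_permE (balphaK B).
    by rewrite !ext_perm_out // !ext_perm_out.
  - move=> _ /imsetP[x _ ->].
    by rewrite ext_permE !(inj_eq fI) (balpha_fix B) ?inE.
  - move=> _ A /imsetP[x _ ->] sA aA rA.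
    have aA' : edge_stable a x (f @^-1: A).
      apply/edge_stableP => y yx yax; rewrite !inE -ext_permE.
      by apply: (edge_stableP _ _ _ aA); rewrite ?ext_permE (inj_eq fI).
    have := bconn B (in_setT x) (stable_ext_preim sA) aA'.
    rewrite inE rA => /(_ isT)/subsetP TA.
    by apply/subsetP => _ /imsetP[y _ ->]; have := TA y; rewrite !inE => ->.
have [s ps] := ext_perm_surj fI (bsigma_on B).
have [a qa] := ext_perm_surj fI (balpha_on B).
have /imsetP[r _ tr] := broot_in B; subst p q t.
exists (s, a, r) => //; apply/lmapsP; split.
- by apply/subsetP => y; rewrite inE.
- by apply/subsetP => y; rewrite inE.
- by rewrite inE.
- by move=> y; apply: (fI); rewrite -!(ext_permE fI) (balphaK B).
- move=> y _; have := balpha_fix B (imset_f f (in_setT y)).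
  by rewrite ext_permE !(inj_eq fI).
- move=> x A _ sA aA rA.
  have aA' : edge_stable (ext_perm fI a) (f x) (f @: A).
    apply/edge_stableP => y.
    have [/imsetP[z _ ->]|yf] := boolP (y \in f @: setT); last first.
      by rewrite [ext_perm fI a y]ext_perm_out.
    rewrite !ext_permE !(inj_eq fI) !mem_imset //.
    exact: (edge_stableP _ _ _ aA).
  have := bconn B (imset_f f (in_setT x)) (stable_ext_im fI sA) aA'.
  rewrite mem_imset // => /(_ rA)/subsetP TA; apply/subsetP => y _.
  by rewrite -(mem_imset _ _ fI) TA ?imset_f ?inE.
Qed.

Lemma card_lmaps_ext (S T : finType) (f : S -> T) (fI : injective f) :
  #|lmaps (f @: setT)| = #|lmaps [set: S]|.
Proof.
rewrite (lmaps_ext fI) card_imset // => -[[s a] r] [[s' a'] r'] [/=].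
by move=> /ext_perm_inj-> /ext_perm_inj-> /fI->.
Qed.

Definition nlmaps (k : nat) := #|lmaps [set: 'I_k]|.

Lemma card_lmaps (T : finType) (H : {set T}) : #|lmaps H| = nlmaps #|H|.
Proof.
rewrite /nlmaps -(card_lmaps_ext (@enum_val_inj T (mem H))).
congr #|pred_of_set (lmaps _)|; apply/setP => x; apply/idP/imsetP => [xH|[i _ ->]].
  by exists (enum_rank_in xH x); rewrite ?inE // enum_rankK_in.
exact: enum_valP.
Qed.

Lemma nlmaps0 : nlmaps 0 = 0.
Proof. by apply: eq_card0 => -[[s a] r]; case: r. Qed.

Lemma nlmaps1 : nlmaps 1 = 1.
Proof.
have T1 (x : 'I_1) : x = ord0 by apply/val_inj; case: x => -[].
transitivity #|[set (1%g : {perm 'I_1}, 1%g : {perm 'I_1}, ord0 : 'I_1)]|;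
  last by rewrite cards1.
apply: eq_card => -[[s a] r]; rewrite [RHS]inE.
have -> : s = 1%g by apply/permP => x; rewrite [LHS]T1 [RHS]T1.
have -> : a = 1%g by apply/permP => x; rewrite [LHS]T1 [RHS]T1.
rewrite [r]T1 eqxx; apply/lmapsP; split; rewrite ?perm_on1 ?inE //.
- by move=> y; rewrite !perm1.
- by move=> y _; rewrite perm1 eqxx [y]T1.
- by move=> x A _ _ _ A0; apply/subsetP => y _; rewrite [y]T1.
Qed.

(** * Gluing two bridgeless maps *)

(* Gluing along a new bridge [x -- x'], where [x] is inserted after the
   half-edge [y0] of the first map and [x'] is the root of the second; then
   the half-edge [h] following [x'] is moved right after the root [r]. *)
Definition glue_core (T : finType) (s1 s2 : {perm T}) (x y0 x' : T) :=
  (tperm x y0 * (tperm x' (s2 x') * (s1 * s2)))%g.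
Definition glue_sigma (T : finType) (s1 s2 : {perm T}) (r x y0 x' : T) :=
  (tperm r (s2 x') * glue_core s1 s2 x y0 x')%g.
Definition glue_alpha (T : finType) (a1 a2 : {perm T}) (x x' : T) :=
  (tperm x x' * (a1 * a2))%g.

(** The root of the second map becomes the far half [x'] of the bridge, so [x] is the only half-edge
    outside both maps. With j half-edges in [H], the second map has N - 1 - j. *)
Record glueable (T : finType) (H : {set T}) (x y0 : T)
    (s1 a1 : {perm T}) (r : T) (s2 a2 : {perm T}) (x' : T) : Prop := Glueable {
  gl_x : x \notin H;
  gl_y : y0 \in H;
  gl_1 : bridgeless_on H s1 a1 r;
  gl_2 : bridgeless_on (~: (x |: H)) s2 a2 x' }.

Lemma glue_coreP (T : finType) (H : {set T}) x y0 s1 a1 r s2 a2 x'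
    (A : {set T}) :
  glueable H x y0 s1 a1 r s2 a2 x' -> stable (glue_core s1 s2 x y0 x') A ->
  [/\ stable s1 A, (x \in A) = (y0 \in A) &
      stable (tperm x' (s2 x') * s2)%g A].
Proof.
case=> xH y0H B1 B2 cA.
have s1H := bsigma_on B1; have s2H := bsigma_on B2.
have x'H := broot_in B2.
have hH : s2 x' \in ~: (x |: H) by rewrite perm_closed.
have D : [disjoint H & ~: (x |: H)].
  by rewrite disjoints_subset setCK subsetUr.
have xy : (x \in A) = (y0 \in A).
  rewrite -[RHS](stableP _ _ cA) permM tpermR permM tpermD.
  - by rewrite (permMr _ s1H) // (out_perm s2H) // !inE eqxx.
  - by apply: contraTneq x'H => ->; rewrite !inE eqxx.
  - by apply: contraTneq hH => ->; rewrite !inE eqxx.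
have cA' : stable (tperm x' (s2 x') * (s1 * s2))%g A.
  by rewrite -(tpermKg x y0 (_ * _)); apply: stable_tperm.
split=> //; apply/stableP => y; have := stableP _ _ cA' y.
  have [yH|yH _] := boolP (y \in H); last by rewrite (out_perm s1H).
  rewrite permM tpermD ?(permMl s1H s2H) ?inE ?yH ?orbT //.
  - by apply: contraTneq x'H => ->; rewrite !inE yH orbT.
  - by apply: contraTneq hH => ->; rewrite !inE yH orbT.
have [yH _|yH] := boolP (y \in H); last first.
  rewrite !permM [s1 _](out_perm s1H) //.
  by case: tpermP => // _; [move: hH|move: x'H]; rewrite !inE negb_or => /andP[].
rewrite permM tpermD; first by rewrite !(out_perm s2H) // !inE yH orbT.
- by apply: contraTneq x'H => ->; rewrite !inE yH orbT.
- by apply: contraTneq hH => ->; rewrite !inE yH orbT.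
Qed.

Lemma glue_alphaE (T : finType) (H : {set T}) x y0 s1 a1 r s2 a2 x' :
  glueable H x y0 s1 a1 r s2 a2 x' ->
  [/\ glue_alpha a1 a2 x x' x = x', glue_alpha a1 a2 x x' x' = x,
   forall y, y \in H -> glue_alpha a1 a2 x x' y = a1 y &
   forall y, y \in ~: (x |: H) -> y != x' -> glue_alpha a1 a2 x x' y = a2 y].
Proof.
case=> xH yH B1 B2.
have a1H := balpha_on B1; have a2H := balpha_on B2.
have x'H := broot_in B2.
have D : [disjoint H & ~: (x |: H)].
  by rewrite disjoints_subset setCK subsetUr.
have x'H1 : x' \notin H by move: x'H; rewrite !inE negb_or => /andP[].
split.
- by rewrite permM tpermL (permMr _ a1H) // (broot_fix B2).
- by rewrite permM tpermR (permMr _ a1H) // (out_perm a2H) // !inE eqxx.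
- move=> y yH1; rewrite permM tpermD ?(permMl a1H a2H) ?inE ?yH1 ?orbT //.
    by apply: contraNneq xH => ->.
  by apply: contraNneq x'H1 => ->.
- move=> y yH2 yx'; rewrite permM tpermD 1?eq_sym //; last first.
    by apply: contraTneq yH2 => ->; rewrite !inE eqxx.
  by rewrite (permMr _ a1H) //; move: yH2; rewrite !inE negb_or => /andP[].
Qed.

Lemma glue_sigma_root (T : finType) (H : {set T}) x y0 s1 a1 r s2 a2 x' :
  glueable H x y0 s1 a1 r s2 a2 x' -> glue_sigma s1 s2 r x y0 x' r = s2 x'.
Proof.
case=> xH yH B1 B2; have x'H := broot_in B2.
have hH : s2 x' \in ~: (x |: H) by rewrite perm_closed ?(bsigma_on B2).
rewrite permM tpermL permM tpermD.
- rewrite permM tpermR (permMr _ (bsigma_on B1)) //.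
  by move: x'H; rewrite !inE negb_or => /andP[].
- by apply: contraTneq hH => <-; rewrite !inE eqxx.
- by apply: contraTneq hH => <-; rewrite !inE yH orbT.
Qed.

(** The first map is bridgeless, so no single edge [z] can separate [r] from [H], and [x] shares the
    vertex of [y0]. For [z] = [x] this makes [x |: H] the least closed set containing [r], which is
    how injectivity recovers it. *)
Lemma glue_core_first (T : finType) (H : {set T}) x y0 s1 a1 r s2 a2 x' z
    (A : {set T}) :
  glueable H x y0 s1 a1 r s2 a2 x' -> stable (glue_core s1 s2 x y0 x') A ->
  edge_stable (glue_alpha a1 a2 x x') z A -> r \in A -> x |: H \subset A.
Proof.
move=> G cA aA rA.
have [s1A xy _] := glue_coreP G cA.
have [ax ax' aE1 aE2] := glue_alphaE G.
case: (G) => xH yH B1 B2.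
have a1H := balpha_on B1.
suff HA : H \subset A by rewrite subUset HA sub1set xy (subsetP HA).
have [zH|zH] := boolP (z \in H).
  apply: (bconn B1 zH s1A) => //; apply/edge_stableP => y yz yaz.
  have [yH1|yH1] := boolP (y \in H); last by rewrite (out_perm a1H).
  by rewrite -aE1 // (edge_stableP _ _ _ aA) // aE1.
apply: (bconn_full B1 s1A) => //; apply/stableP => y.
have [yH1|yH1] := boolP (y \in H); last by rewrite (out_perm a1H).
rewrite -aE1 // (edge_stableP _ _ _ aA) //.
  by apply: contraNneq zH => <-.
apply: contraTneq yH1 => ->.
have [->|zx] := eqVneq z x.
  by rewrite ax; have := broot_in B2; rewrite !inE negb_or => /andP[].
have [->|zx'] := eqVneq z x'; first by rewrite ax'.
have zH2 : z \in ~: (x |: H) by rewrite !inE negb_or zx.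
rewrite aE2 //; have : a2 z \in ~: (x |: H) by rewrite perm_closed ?(balpha_on B2).
by rewrite !inE negb_or => /andP[].
Qed.

Lemma glue_core_stable (T : finType) (H : {set T}) x y0 s1 a1 r s2 a2 x' :
  glueable H x y0 s1 a1 r s2 a2 x' ->
  stable (glue_core s1 s2 x y0 x') (x |: H).
Proof.
case=> xH yH B1 B2.
have x'H := broot_in B2.
have hH : s2 x' \in ~: (x |: H) by rewrite perm_closed ?(bsigma_on B2).
apply: stable_tperm; first by rewrite !inE eqxx yH orbT.
apply: stable_tperm; first by move: hH x'H; rewrite inE => /negPf->; rewrite inE => /negPf.
apply: stableM; last by rewrite -[x |: H]setCK; apply/stableC/perm_on_stable/(bsigma_on B2).
apply/perm_on_stable/(subset_trans (bsigma_on B1)); exact: subsetUr.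
Qed.

Lemma glue_alpha_stable (T : finType) (H : {set T}) x y0 s1 a1 r s2 a2 x' :
  glueable H x y0 s1 a1 r s2 a2 x' ->
  forall y, y \in x |: H ->
    (glue_alpha a1 a2 x x' y \in x |: H) = (y != x).
Proof.
move=> G; have [ax _ aE1 _] := glue_alphaE G.
case: (G) => xH yH B1 B2 y; rewrite !in_setU1.
have := broot_in B2; rewrite !inE => /norP[x'x x'H].
have [-> _|yx /= yH1] := eqVneq y x; first by rewrite ax (negPf x'x) (negPf x'H).
by rewrite aE1 // perm_closed ?(balpha_on B1) // yH1 orbT.
Qed.

Lemma glue_alphaK (T : finType) (H : {set T}) x y0 s1 a1 r s2 a2 x' y :
  glueable H x y0 s1 a1 r s2 a2 x' ->
  glue_alpha a1 a2 x x' (glue_alpha a1 a2 x x' y) = y.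
Proof.
move=> G; have [ax ax' aE1 aE2] := glue_alphaE G.
case: (G) => xH yH B1 B2.
have [->|yx] := eqVneq y x; first by rewrite ax ax'.
have [->|yx'] := eqVneq y x'; first by rewrite ax' ax.
have [yH1|yH1] := boolP (y \in H).
  by rewrite !aE1 ?perm_closed ?(balpha_on B1) // (balphaK B1).
have yH2 : y \in ~: (x |: H) by rewrite !inE negb_or yx.
rewrite (aE2 y) // aE2 ?perm_closed ?(balpha_on B2) ?(balphaK B2) //.
by apply: contraNneq yx' => E; rewrite -(inj_eq (@perm_inj _ a2)) E (broot_fix B2).
Qed.

Lemma glue_bridgeless (T : finType) (H : {set T}) x y0 s1 a1 r s2 a2 x' :
  glueable H x y0 s1 a1 r s2 a2 x' ->
  bridgeless_on setT (glue_sigma s1 s2 r x y0 x') (glue_alpha a1 a2 x x') r.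
Proof.
move=> G; have [ax ax' aE1 aE2] := glue_alphaE G.
have rE := glue_sigma_root G; have aK := glue_alphaK _ G.
case: (G) => xH yH B1 B2.
have s2H := bsigma_on B2; have a2H := balpha_on B2.
have x'H := broot_in B2; have rH := broot_in B1.
have x'V : x' \notin x |: H by move: x'H; rewrite inE.
split=> //.
- by apply/subsetP => y; rewrite !inE.
- by apply/subsetP => y; rewrite !inE.
- move=> y _.
  have [yH1|yH1] := boolP (y \in H); first by rewrite aE1 // (balpha_fix B1).
  have yr : y != r by apply: contraNneq yH1 => ->.
  rewrite (negPf yr); apply/negbTE.
  have [->|yx] := eqVneq y x; first by rewrite ax; apply: contraNneq x'V => ->; rewrite !inE eqxx.
  have [->|yx'] := eqVneq y x'; first by rewrite ax'; apply: contraNneq x'V => <-; rewrite !inE eqxx.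
  have yH2 : y \in ~: (x |: H) by rewrite !inE negb_or yx.
  by rewrite aE2 // (balpha_fix B2).
move=> z A _ sA aA rA.
have hA : s2 x' \in A by rewrite -rE (stableP _ _ sA).
have cA : stable (glue_core s1 s2 x y0 x') A.
  by rewrite -(tpermKg r (s2 x') (glue_core _ _ _ _ _)); apply: stable_tperm; rewrite ?rA ?hA.
have VA := glue_core_first G cA aA rA.
have [_ _ s2A'] := glue_coreP G cA.
have xA : x \in A by rewrite (subsetP VA) ?setU11.
suff H2A : ~: (x |: H) \subset A by rewrite -(setUCr (x |: H)) subUset VA.
have s2A : x' \in A -> stable s2 A.
  by move=> x'A; rewrite -(tpermKg x' (s2 x') s2); apply: stable_tperm; rewrite ?x'A ?hA.
(* When the new edge is deleted, [x'] is still reached from [r] through [s2 x']: by [bdetach], the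
   second map stays connected after that half-edge has left its vertex. *)
have [zx|zx] := boolP (z \in [set x; x']).
  have a2A : stable a2 A.
    apply/stableP => y.
    have [yH2|yH2] := boolP (y \in ~: (x |: H)); last by rewrite (out_perm a2H).
    have [->|yx'] := eqVneq y x'; first by rewrite (broot_fix B2).
    have yx : y != x by apply: contraTneq yH2 => ->; rewrite !inE eqxx.
    rewrite -aE2 // (edge_stableP _ _ _ aA) //.
      by move: zx; rewrite !inE => /orP[]/eqP->.
    by move: zx; rewrite !inE => /orP[]/eqP->; rewrite ?ax ?ax'.
  have x'A : x' \in A by rewrite -(bdetach B2 s2A' a2A).
  exact: (bconn_full B2 (s2A x'A)).
move: zx; rewrite !inE negb_or => /andP[zx zx'].
have x'A : x' \in A.
  rewrite -ax (edge_stableP _ _ _ aA) 1?eq_sym //.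
  by rewrite -(inj_eq (@perm_inj _ (glue_alpha a1 a2 x x'))) aK ax.
have [zH|zH] := boolP (z \in ~: (x |: H)); last first.
  have zH1 : z \in H by move: zH; rewrite !inE negb_or zx negbK.
  apply: (bconn_full B2 (s2A x'A)) => //; apply/stableP => y.
  have [yH2|yH2] := boolP (y \in ~: (x |: H)); last by rewrite (out_perm a2H).
  have [->|yx'] := eqVneq y x'; first by rewrite (broot_fix B2).
  rewrite -aE2 // (edge_stableP _ _ _ aA) //.
    by apply: contraTneq yH2 => ->.
  by apply: contraTneq yH2 => ->; rewrite aE1 // !inE perm_closed ?(balpha_on B1) // zH1 orbT.
apply: (bconn B2 zH (s2A x'A)) => //; apply/edge_stableP => y yz yaz.
have [yH2|yH2] := boolP (y \in ~: (x |: H)); last by rewrite (out_perm a2H).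
have [->|yx'] := eqVneq y x'; first by rewrite (broot_fix B2).
by rewrite -aE2 // (edge_stableP _ _ _ aA) // aE2.
Qed.

Lemma glue_core_y (T : finType) (H : {set T}) x y0 s1 a1 r s2 a2 x' :
  glueable H x y0 s1 a1 r s2 a2 x' -> glue_core s1 s2 x y0 x' y0 = x.
Proof.
case=> xH yH B1 B2.
have hH : s2 x' \in ~: (x |: H) by rewrite perm_closed ?(bsigma_on B2) ?(broot_in B2).
rewrite permM tpermR permM tpermD.
- by rewrite (permMr _ (bsigma_on B1)) // (out_perm (bsigma_on B2)) // !inE eqxx.
- by apply: contraTneq (broot_in B2) => ->; rewrite !inE eqxx.
- by apply: contraTneq hH => ->; rewrite !inE eqxx.
Qed.

Lemma glue_edge_stable (T : finType) (H : {set T}) x y0 s1 a1 r s2 a2 x' :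
  glueable H x y0 s1 a1 r s2 a2 x' ->
  edge_stable (glue_alpha a1 a2 x x') x (x |: H).
Proof.
move=> G; apply/edge_stableP => y yx yax.
have [yV|yV] := boolP (y \in x |: H); first by rewrite (glue_alpha_stable G yV).
apply: contraNF yV => /(glue_alpha_stable G); rewrite (glue_alphaK _ G) => ->.
by apply: contraNneq yax => E; rewrite -[X in X == _](glue_alphaK _ G) E.
Qed.

(** The glued map determines [s2 x'] as the successor of [r], hence the core, hence [x |: H] by
    minimality. In this set [x] is the only half-edge whose partner lies outside, [x'] is that
    partner, and [y0] precedes [x] in the core. *)
Lemma glue_inj (T : finType) r (H K : {set T}) x y0 s1 a1 s2 a2 x' w v0 t1 b1 t2 b2 w' :
  glueable H x y0 s1 a1 r s2 a2 x' -> glueable K w v0 t1 b1 r t2 b2 w' ->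
  glue_sigma s1 s2 r x y0 x' = glue_sigma t1 t2 r w v0 w' ->
  glue_alpha a1 a2 x x' = glue_alpha b1 b2 w w' ->
  [/\ H = K, x = w, y0 = v0, x' = w' & [/\ s1 = t1, a1 = b1, s2 = t2 & a2 = b2]].
Proof.
move=> G F Es Ea.
have Eh : s2 x' = t2 w' by rewrite -(glue_sigma_root G) -(glue_sigma_root F) Es.
have Ec : glue_core s1 s2 x y0 x' = glue_core t1 t2 w v0 w'.
  by apply: (mulgI (tperm r (s2 x'))); rewrite {2}Eh.
have EV : x |: H = w |: K.
  apply/eqP; rewrite eqEsubset; apply/andP; split.
    apply: (glue_core_first (z := w) G); rewrite ?Ec ?Ea.
    - exact: glue_core_stable F.
    - exact: glue_edge_stable F.
    - by rewrite inE (broot_in (gl_1 F)) orbT.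
  apply: (glue_core_first (z := x) F); rewrite -?Ec -?Ea.
  - exact: glue_core_stable G.
  - exact: glue_edge_stable G.
  - by rewrite inE (broot_in (gl_1 G)) orbT.
have xw : x = w.
  apply/eqP; have := glue_alpha_stable F; rewrite -EV => /(_ x (setU11 _ _)).
  by rewrite -Ea (glue_alpha_stable G (setU11 _ _)) eqxx; case: eqP.
subst w.
have HK : H = K by rewrite -(setU1K (gl_x G)) EV (setU1K (gl_x F)).
have [Gx _ _ _] := glue_alphaE G; have [Fx _ _ _] := glue_alphaE F.
have xw' : x' = w' by rewrite -Gx Ea Fx.
have yv : y0 = v0.
  by apply: (@perm_inj _ (glue_core s1 s2 x y0 x')); rewrite (glue_core_y G) Ec (glue_core_y F).
subst K w' v0.
have D : [disjoint H & ~: (x |: H)] by rewrite disjoints_subset setCK subsetUr.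
have E12 : (s1 * s2 = t1 * t2)%g.
  by move: Ec; rewrite /glue_core Eh => /mulgI/mulgI.
have F12 : (a1 * a2 = b1 * b2)%g by move: Ea => /mulgI.
case: G F => _ _ B1 B2 [_ _ C1 C2].
have [-> ->] := perm_on_mul_inj D (bsigma_on B1) (bsigma_on B2) (bsigma_on C1) (bsigma_on C2) E12.
by have [-> ->] := perm_on_mul_inj D (balpha_on B1) (balpha_on B2) (balpha_on C1) (balpha_on C2) F12.
Qed.

Lemma glue_surj (T : finType) (s a : {perm T}) r :
  1 < #|T| -> bridgeless_on setT s a r ->
  exists H x y0 s1 a1 s2 a2 x', [/\ glueable H x y0 s1 a1 r s2 a2 x',
    s = glue_sigma s1 s2 r x y0 x' & a = glue_alpha a1 a2 x x'].
Proof.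
move=> T1 B; have aK := balphaK B; have ar := broot_fix B.
have [h hE] : exists h, s r = h by exists (s r).
have hr : h != r.
  apply: contraTneq T1 => hr; rewrite -leqNgt -cardsT -(cards1 r); apply: subset_leq_card.
  apply: (bconn_full B); rewrite ?inE //; apply/stableP => y; rewrite !inE.
    by rewrite -{1}hr -hE (inj_eq perm_inj).
  by rewrite -{1}ar (inj_eq perm_inj).
have [s' s'E] : exists s' : {perm T}, (tperm r h * s)%g = s' by exists (tperm r h * s)%g.
have sE : (tperm r h * s')%g = s by rewrite -s'E tpermKg.
have s'h : s' h = h by rewrite -s'E permM tpermR.
(* [V] is the near side of the first bridge between [r] and [h] once [h] is detached; its minimal
   size is what will make the first piece bridgeless. *)
have [x [V [xV axV [sV aV rV hV] Vmin]]] : exists x (V : {set T}),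
   [/\ x \in V, a x \notin V,
    [/\ stable s' V, edge_stable a x V, r \in V & h \notin V] &
    forall z (A : {set T}), stable s' A -> edge_stable a z A -> r \in A -> h \notin A ->
      #|V| <= #|A|].
  pose Q (p : T * {set T}) :=
    [&& stable s' p.2, edge_stable a p.1 p.2, r \in p.2 & h \notin p.2].
  (* A candidate exists: the detached [h] is alone in its vertex, so its edge cuts it off. *)
  have Q0 : Q (h, ~: [set h]).
    rewrite /Q /= !inE negbK eqxx eq_sym hr !andbT; apply/andP; split.
      by apply/stableP => y; rewrite !inE -{1}s'h (inj_eq perm_inj).
    apply/edge_stableP => y yh yah; rewrite !inE yh.
    by rewrite -(inj_eq (@perm_inj _ a)) aK.
  case: (@arg_minnP _ (h, ~: [set h]) Q (fun p => #|p.2|) Q0) => -[z V].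
  case/and4P=> /= sV aV rV hV Vmin.
  have Vm z' (A : {set T}) : stable s' A -> edge_stable a z' A -> r \in A -> h \notin A ->
      #|V| <= #|A|.
    by move=> *; apply: (Vmin (z', A)); apply/and4P.
  (* Otherwise no edge would leave [V], against [bdetach]. So exactly one half of the bridge is in
     [V], and it is named [x]. *)
  have zaz : (a z \in V) != (z \in V).
    apply: contraNneq hV => E; rewrite -hE (bdetach B) ?hE ?s'E //.
    apply/stableP => y; have [->//|yz] := eqVneq y z.
    have [->|yaz] := eqVneq y (a z); first by rewrite aK.
    exact: (edge_stableP _ _ _ aV).
  case zV : (z \in V) zaz; case azV : (a z \in V) => // _.
    by exists z, V; split; rewrite ?azV.
  exists (a z), V; split; rewrite ?aK ?zV ?azV //; split=> //.
  by apply/edge_stableP => y yz yaz; apply: (edge_stableP _ _ _ aV); rewrite -1?[z]aK // aK.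
have [x' x'E] : exists x', a x = x' by exists (a x).
rewrite x'E in axV; have ax' : a x' = x by rewrite -x'E aK.
have x'x : x' != x by apply: contraNneq axV => ->.
have xr : x != r by apply: contraNneq axV => xr; rewrite -x'E xr ar.
have [y0 y0E] : exists y0, s' y0 = x by exists ((s'^-1)%g x); rewrite permKV.
have y0V : y0 \in V by rewrite -(stableP _ _ sV) y0E.
(* If [x] were alone in its vertex, [V :\ x] would be closed under all moves of the detached map and
   still separate [r] from [h]. *)
have y0x : y0 != x.
  apply/eqP => y0x; rewrite y0x in y0E.
  have : h \in V :\ x; last by rewrite inE (negPf hV) andbF.
  rewrite -hE (bdetach B) ?hE ?s'E.
  - by rewrite !inE eq_sym xr.
  - by apply/stableP => y; rewrite !inE (stableP _ _ sV) -{1}y0E (inj_eq perm_inj).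
  - apply: stable_inv => // y; rewrite !inE => /andP[yx yV].
    have yx' : y != x' by apply: contraNneq axV => <-.
    rewrite (edge_stableP _ _ _ aV) ?x'E // yV andbT.
    by apply: contraNneq yx' => E; rewrite -x'E -E aK.
pose H := V :\ x; have HV : x |: H = V by rewrite setD1K.
have rH : r \in H by rewrite !inE eq_sym xr.
have y0H : y0 \in H by rewrite !inE y0x.
have xH : x \notin H by rewrite !inE eqxx.
have x'H : x' \notin H by rewrite !inE (negPf axV) andbF.
have hH : h \notin H by rewrite !inE (negPf hV) andbF.
(* Undoes [glue_core]: [x] is taken out after [y0], and [h] is put back after [x']. *)
have [t tE] : exists t : {perm T}, (tperm x' h * (tperm x y0 * s'))%g = t.
  by exists (tperm x' h * (tperm x y0 * s'))%g.
have s'Et : (tperm x y0 * (tperm x' h * t))%g = s' by rewrite -tE !tpermKg.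
have tV : stable t V.
  rewrite -tE; apply: stable_tperm; first by rewrite (negPf axV) (negPf hV).
  by apply: stable_tperm; rewrite ?xV ?y0V.
have hx : h != x by apply: contraNneq hV => ->.
have hy0 : h != y0 by apply: contraNneq hV => ->.
have tx : t x = x by rewrite -tE permM tpermD // permM tpermL.
have tx' : t x' = h by rewrite -tE permM tpermL permM tpermD // eq_sym.
have fixD (p : {perm T}) : stable p V -> p x = x -> stable p H.
  move=> pV px; apply/stableP => y.
  by rewrite !inE (stableP _ _ pV) -{1}px (inj_eq perm_inj).
have tH := fixD t tV tx.
have [b bE] : exists b : {perm T}, (tperm x x' * a)%g = b by exists (tperm x x' * a)%g.
have aE : (tperm x x' * b)%g = a by rewrite -bE tpermKg.
have bx : b x = x by rewrite -bE permM tpermL.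
have bx' : b x' = x' by rewrite -bE permM tpermR.
have by' y : y != x -> y != x' -> b y = a y.
  by move=> yx yx'; rewrite -bE permM tpermD // eq_sym.
have bV : stable b V.
  apply/stableP => y; have [->|yx] := eqVneq y x; first by rewrite bx.
  have [->|yx'] := eqVneq y x'; first by rewrite bx'.
  by rewrite by' // (edge_stableP _ _ _ aV) // x'E.
have bH := fixD b bV bx.
have bK y : b (b y) = y.
  have [->|yx] := eqVneq y x; first by rewrite !bx.
  have [->|yx'] := eqVneq y x'; first by rewrite !bx'.
  rewrite -[RHS]aK [b y]by' // by' //.
    by apply: contraNneq yx' => E; rewrite -x'E -E aK.
  by apply: contraNneq yx => E; rewrite -[y]aK E ax'.
have bCV := stableC bV; have tCV := stableC tV.
exists H, x, y0, (restr_perm H t), (restr_perm H b),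
  (restr_perm (~: V) t), (restr_perm (~: V) b), x'.
have s2x' : restr_perm (~: V) t x' = h by rewrite restr_permP // inE axV.
split; last 2 first.
- by rewrite /glue_sigma /glue_core s2x' restr_permM // s'Et.
- by rewrite /glue_alpha restr_permM.
split=> //; last rewrite HV; split; rewrite ?restr_perm_on ?in_setC ?axV //.
- move=> y; rewrite (restr_permP y bH).
  by case: ifP => yH; rewrite (restr_permP _ bH) ?(stableP _ _ bH) yH ?bK.
- move=> y yH; have [yx yx'] : y != x /\ y != x'.
    by split; [apply: contraNneq xH|apply: contraNneq x'H] => <-.
  by rewrite restr_permP // yH by' // (balpha_fix B) ?inE.
- move=> z A zH sA aA rA.
  have [zx zx'] : z != x /\ z != x'.
    by split; [apply: contraNneq xH|apply: contraNneq x'H] => <-.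
  (* Everything outside [H] is put on the side of [y0], the corner at which it hangs, so that [C] is
     closed in the whole detached map. *)
  pose C := if y0 \in A then A :&: H :|: ~: H else A :&: H.
  have outC y : y \notin H -> (y \in C) = (y0 \in A).
    rewrite /C => yH.
    by case: (y0 \in A); rewrite ?in_setU ?in_setC in_setI (negPf yH) ?andbF.
  have inC y : y \in H -> (y \in C) = (y \in A).
    move=> yH; rewrite /C.
    by case: ifP => _; rewrite ?in_setU ?in_setC in_setI yH andbT ?orbF.
  have sC : stable s' C.
    rewrite -s'Et; apply: stable_tperm; first by rewrite outC // inC.
    apply: stable_tperm; first by rewrite !outC.
    have tAH := stable_restrI tH sA.
    by rewrite /C; case: ifP => _ //; apply: stableU => //; apply: stableC.
  have aC : edge_stable a z C.
    apply/edge_stableP => y yz yaz.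
    have [->|yx] := eqVneq y x; first by rewrite x'E !outC.
    have [->|yx'] := eqVneq y x'; first by rewrite ax' !outC.
    rewrite -by' //; have [yH|yH] := boolP (y \in H); last first.
      by rewrite !outC ?(stableP _ _ bH).
    rewrite !inC ?(stableP _ _ bH) //.
    have := edge_stableP _ _ _ aA y yz; rewrite !restr_permP // zH yH by' //.
    by move/(_ yaz).
  have rC : r \in C by rewrite inC.
  (* If [y0] is not in [A], then [C] is a smaller candidate than [V]. If it is, [C] contains both
     [r] and [h], hence is stable for the original [s]. *)
  have [y0A|y0A] := boolP (y0 \in A); last first.
    have := Vmin z C sC aC rC; rewrite outC // y0A => /(_ isT).
    rewrite /C (negPf y0A) => VA.
    have := leq_trans VA (subset_leq_card (subsetIr A H)).
    by rewrite (cardsD1 x V) xV add1n ltnn.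
  have sC' : stable s C.
    by rewrite -sE; apply: stable_tperm; rewrite ?rC ?outC ?y0A.
  have /subsetP TC := bconn B (in_setT z) sC' aC rC.
  by apply/subsetP => y yH; rewrite -inC // TC ?inE.
- move=> y; rewrite (restr_permP y bCV).
  by case: ifP => yH; rewrite (restr_permP _ bCV) ?(stableP _ _ bCV) yH ?bK.
- move=> y yV; rewrite restr_permP // yV.
  have [->|yx'] := eqVneq y x'; first by rewrite bx' eqxx.
  have yx : y != x by apply: contraTneq yV => ->; rewrite inE xV.
  rewrite by' // (balpha_fix B) ?inE //; apply/negbTE.
  by apply: contraTneq yV => ->; rewrite inE rV.
move=> z A zV sA aA x'A.
have hA : h \in A by rewrite -s2x' (stableP _ _ sA).
(* The near side is added whole: it contains [r] and [x], while [h] and [x'] are already in [A], so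
   all reattachments respect [C]. *)
pose C := A :&: ~: V :|: V.
have VC y : y \in V -> y \in C by move=> yV; rewrite in_setU yV orbT.
have AC y : y \in ~: V -> (y \in C) = (y \in A).
  by move=> yV; rewrite in_setU in_setI yV; move: yV; rewrite in_setC => /negPf->; rewrite andbT orbF.
have x'C : x' \in C by rewrite AC ?inE ?axV.
have hC : h \in C by rewrite AC ?inE ?hV.
have sC : stable s C.
  rewrite -sE; apply: stable_tperm; first by rewrite hC VC.
  rewrite -s'Et; apply: stable_tperm; first by rewrite !VC.
  apply: stable_tperm; first by rewrite hC x'C.
  by apply: stableU => //; apply: stable_restrI.
have aC : edge_stable a z C.
  apply/edge_stableP => y yz yaz.
  have [->|yx] := eqVneq y x; first by rewrite x'E x'C VC.
  have [->|yx'] := eqVneq y x'; first by rewrite ax' x'C VC.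
  rewrite -by' //; have [yV|yV] := boolP (y \in V).
    by rewrite !VC ?(stableP _ _ bV).
  have yV' : y \in ~: V by rewrite inE yV.
  rewrite !AC ?(stableP _ _ bCV) //.
  have := edge_stableP _ _ _ aA y yz; rewrite !restr_permP // zV yV'; apply.
  have [->|zx'] := eqVneq z x'; first by rewrite bx'.
  by rewrite by' //; apply: contraTneq zV => ->; rewrite inE xV.
have /subsetP TC := bconn B (in_setT z) sC aC (VC r rV).
by apply/subsetP => y yV; rewrite -AC // TC ?inE.
Qed.

(** * Counting maps *)

(** The pair [p] is ([H], [x]), and the factor [#|p.1|] counts the corners [y0]. The root of the
    whole map is that of the first piece. *)
Lemma card_lmaps_glue (T : finType) : 1 < #|T| ->
  #|lmaps [set: T]| = \sum_(p : {set T} * T | p.2 \notin p.1)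
     #|lmaps p.1| * #|p.1| * #|lmaps (~: (p.2 |: p.1))|.
Proof.
move=> T1; pose rmapT := ({perm T} * {perm T} * T)%type.
pose D (p : {set T} * T) := setX (setX (lmaps p.1) p.1) (lmaps (~: (p.2 |: p.1))).
pose Q := [set q : ({set T} * T) * (rmapT * T * rmapT) |
  (q.1.2 \notin q.1.1) && (q.2 \in D q.1)].
pose glue (q : ({set T} * T) * (rmapT * T * rmapT)) : rmapT :=
  let: ((H, x), ((s1, a1, r), y0, (s2, a2, x'))) := q in
  (glue_sigma s1 s2 r x y0 x', glue_alpha a1 a2 x x', r).
have QP H x s1 a1 r y0 s2 a2 x' : reflect (glueable H x y0 s1 a1 r s2 a2 x')
    (((H, x), ((s1, a1, r), y0, (s2, a2, x'))) \in Q).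
  rewrite inE !in_setX /=; apply: (iffP and3P).
    by case=> xH /andP[/lmapsP B1 yH] /lmapsP B2.
  by case=> xH yH /lmapsP B1 /lmapsP B2; rewrite B1.
have -> : lmaps [set: T] = glue @: Q.
  apply/setP => -[[s a] r]; apply/lmapsP/imsetP => [B|].
    have [H [x [y0 [s1 [a1 [s2 [a2 [x' [G -> ->]]]]]]]]] := glue_surj T1 B.
    by exists ((H, x), ((s1, a1, r), y0, (s2, a2, x'))) => //; apply/QP.
  move=> [[[H x] [[[[s1 a1] t] y0] [[s2 a2] x']]] /QP G [-> -> ->]].
  exact: glue_bridgeless G.
rewrite card_in_imset; last first.
  move=> [[H x] [[[[s1 a1] r] y0] [[s2 a2] x']]].
  move=> [[K w] [[[[t1 b1] r'] v0] [[t2 b2] w']]] /QP G /QP F [Es Ea Er].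
  subst r'.
  by have [-> -> -> -> [-> -> -> ->]] := glue_inj G F Es Ea.
rewrite -sum1_card.
transitivity (\sum_(p : {set T} * T | p.2 \notin p.1) \sum_(m in D p) 1).
  by rewrite pair_big_dep; apply: eq_bigl => q; rewrite inE.
by apply: eq_bigr => p _; rewrite sum1_card !cardsX.
Qed.

Lemma nlmaps_rec N : 1 < N ->
  nlmaps N = \sum_(j < N) 'C(N, j) * (N - j) * j * nlmaps j * nlmaps (N.-1 - j).
Proof.
move=> N1; rewrite {1}/nlmaps card_lmaps_glue ?card_ord //.
pose G j := j * nlmaps j * nlmaps (N.-1 - j).
transitivity (\sum_(p : {set 'I_N} * 'I_N | p.2 \notin p.1) G #|p.1|).
  apply: eq_bigr => -[H x] /= xH; rewrite !card_lmaps [#|~: _|]cardsCs setCK cardsU1 xH card_ord.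
  by rewrite /G [nlmaps _ * _]mulnC; congr (_ * nlmaps _); rewrite subnDA subn1.
transitivity (\sum_(H : {set 'I_N}) \sum_(x | x \notin H) G #|H|).
  by rewrite pair_big_dep.
transitivity (\sum_(H : {set 'I_N}) (N - #|H|) * G #|H|).
  apply: eq_bigr => H _; rewrite sum_nat_const; congr (_ * _).
  transitivity #|~: H|; first by apply: eq_card => x; rewrite inE.
  by apply/eqP; rewrite -(eqn_add2l #|H|) cardsC card_ord subnKC // -[X in _ <= X](card_ord N) max_card.
rewrite (partition_big (fun H : {set 'I_N} => inord #|H| : 'I_N.+1) xpredT) //=.
(* The term with [H] the full set vanishes, as it leaves no choice for [x]. *)
rewrite big_ord_recr /= [X in _ + X]big1 ?addn0; last first.
  move=> H /eqP/(congr1 val) /=; rewrite inordK; last first.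
    by rewrite ltnS -[X in _ <= X](card_ord N) max_card.
  by move=> ->; rewrite subnn.
apply: eq_bigr => j _.
rewrite (eq_bigr (fun=> (N - j) * G j)); last first.
  move=> H /eqP/(congr1 val) /=; rewrite inordK => [->//|].
  by rewrite ltnS -[X in _ <= X](card_ord N) max_card.
rewrite sum_nat_const /G !mulnA; congr (_ * _ * _ * _ * _).
have := card_draws 'I_N j; rewrite card_ord => <-.
apply: eq_card => H; rewrite inE unfold_in /= inordK //.
by rewrite ltnS -[X in _ <= X](card_ord N) max_card.
Qed.

(** * From labelled maps to isomorphism classes *)

Lemma bconn_any (T : finType) s a r x y (A : {set T}) :
  bridgeless_on setT s a r -> stable s A -> edge_stable a x A -> y \in A ->
  forall z, z \in A.
Proof.
move=> B sA aA yA z; have [rA|rA] := boolP (r \in A).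
  by rewrite (subsetP (bconn B (in_setT x) sA aA rA)) ?inE.
have := bconn B (in_setT x) (stableC sA) (edge_stableC aA).
by rewrite inE rA => /(_ isT)/subsetP/(_ y); rewrite !inE yA => /(_ isT).
Qed.

Lemma porbit_sub_stable (T : finType) (s : {perm T}) (A : {set T}) h :
  stable s A -> (porbit s h \subset A) = (h \in A).
Proof.
move=> /stableP sA; apply/subsetP/idP => [->//|hA y /porbitP[i ->]].
  exact: porbit_id.
by elim: i => [|i IH]; rewrite ?expg0 ?perm1 // expgSr permM sA.
Qed.

Lemma porbit_involution (T : finType) (a : {perm T}) (x y : T) :
  (forall z, a (a z) = z) -> (y \in porbit a x) = (y \in [set x; a x]).
Proof.
move=> aK; apply/idP/idP => [/porbitP[i ->]|].
  elim: i => [|i]; first by rewrite expg0 perm1 !inE eqxx.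
  by rewrite expgSr permM !inE => /orP[]/eqP->; rewrite ?aK eqxx ?orbT.
by rewrite !inE => /orP[]/eqP->; rewrite ?porbit_id // (mem_porbit a 1).
Qed.

(** A set of half-edges stable under [s] is a union of vertices, so paths of vertices avoiding an
    edge and [edge_stable] sets express the same connectivity. *)
Lemma bridgeless_mapsE k : bridgeless_maps k = lmaps [set: 'I_k].
Proof.
apply/setP => -[[s a] r]; rewrite inE; apply/andP/lmapsP.
  case=> /andP[/andP[/forallP /= aK /forallP /= afix] _] /forall_inP br.
  have {}aK y : a (a y) = y by apply/eqP/aK.
  split; rewrite ?in_setT //; try by apply/subsetP => y; rewrite in_setT.
  - by move=> y _; exact: (eqP (afix y)).
  move=> x A _ sA aA rA; apply/subsetP => y _.
  have xe : medge (s, a, r) x \in medges (s, a, r) by apply: imset_f; rewrite inE.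
  have vV z : porbit s z \in mvertices (s, a, r).
    by apply: (imset_f (mvertex (s, a, r))); rewrite inE.
  have := br _ xe; rewrite /is_bridge xe negbK => /forall_inP/(_ _ (vV r)).
  move=> /forall_inP/(_ _ (vV y)) ry.
  rewrite -(porbit_sub_stable y sA).
  suff /closed_connect/(_ _ _ ry) : closed (adj_minus (s, a, r) (medge (s, a, r) x))
      [pred u : {set 'I_k} | u \subset A].
    by rewrite !inE porbit_sub_stable // rA => <-.
  move=> u v /existsP[h /and3P[/eqP-> /eqP-> hx]]; rewrite !inE.
  rewrite !porbit_sub_stable //= (edge_stableP _ _ _ aA) //.
    by apply: contraNneq hx => ->.
  by apply: contraNneq hx => ->; rewrite eq_porbit_mem (mem_porbit a 1).
move=> B; have aK := balphaK B; split.
  apply/andP; split; first (apply/andP; split).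
  - by apply/forallP => y; rewrite aK.
  - by apply/forallP => y; rewrite (balpha_fix B) ?inE.
  apply/forallP => h; apply/eqP/setP => y; rewrite inE.
  set G := <<_>>%g.
  have orbG g : g \in G -> stable g (orbit 'P%act G h).
    by move=> gG; apply/stableP => z; exact: (@orbit_actr _ _ 'P%act (generated_group _) g h z gG).
  apply: (bconn_any (x := r) (y := h) B); last exact: orbit_refl.
    by apply: orbG; rewrite mem_gen // !inE eqxx.
  by apply/stable_edge/orbG; rewrite mem_gen // !inE eqxx orbT.
apply/forall_inP => _ /imsetP[x _ ->]; rewrite /is_bridge negb_and negbK.
apply/orP; right; apply/forall_inP => _ /imsetP[g _ ->].
apply/forall_inP => _ /imsetP[h _ ->].
set e := adj_minus _ _.
(* The half-edges whose vertex is reachable from that of [g] without the edge of [x] form a closed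
   set, hence all of them. *)
suff: h \in [set y | connect e (porbit s g) (porbit s y)] by rewrite inE.
apply: (bconn_any (x := x) (y := g) B); last by rewrite inE connect0.
  by apply/stableP => y; rewrite !inE (porbit_perm s 1).
have sym y : y != x -> y != a x -> e (porbit s y) (porbit s (a y)).
  move=> yx yax; apply/existsP; exists y; rewrite !eqxx /=.
  by rewrite eq_porbit_mem porbit_involution // !inE negb_or yx.
apply/edge_stableP => y yx yax; rewrite !inE; apply/idP/idP => c.
  apply: connect_trans c (connect1 _); rewrite -{2}(aK y); apply: sym.
    by apply: contraNneq yax => <-; rewrite aK.
  by rewrite (inj_eq perm_inj).
by apply: connect_trans c (connect1 _); apply: sym.
Qed.

Definition map_conj k (f : {perm 'I_k}) (M : rmap k) : rmap k :=
  ((M.1.1 ^ f)%g, (M.1.2 ^ f)%g, f M.2).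

Lemma rmap_isoP k (M M' : rmap k) :
  reflect (exists f, M' = map_conj f M) (rmap_iso M M').
Proof.
apply: (iffP existsP) => -[f].
  case: M M' => [[s a] r] [[s' a'] r'] /andP[/andP[/forallP Hs /forallP Ha] /eqP Hr].
  exists f; rewrite /map_conj /=; congr (_, _, _) => //; apply/permP => y.
  - by rewrite -[y](permKV f) permJ (eqP (Hs _)).
  - by rewrite -[y](permKV f) permJ (eqP (Ha _)).
move=> ->; exists f; rewrite /map_conj /= eqxx andbT; apply/andP.
by split; apply/forallP => y; rewrite permJ.
Qed.

Lemma lmaps_conj k (f : {perm 'I_k}) M :
  M \in lmaps [set: 'I_k] -> map_conj f M \in lmaps [set: 'I_k].
Proof.
have fT : f @: setT = [set: 'I_k].
  by apply/setP => y; rewrite inE -[y](permKV f) imset_f ?inE.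
move=> ML; rewrite -{1}fT (lmaps_ext perm_inj); apply/imsetP; exists M => //.
rewrite /map_conj; congr (_, _, _); apply/permP => y;
  by rewrite -[y](permKV f) permJ ext_permE.
Qed.

(* Rooted maps are rigid: two isomorphisms agree on a connected set of
   half-edges containing the root. *)
Lemma map_conj_inj k M : M \in lmaps [set: 'I_k] ->
  injective (fun f : {perm 'I_k} => map_conj f M).
Proof.
case: M => [[s a] r] /lmapsP B f g [Es Ea Er].
have agree (t : {perm 'I_k}) : (t ^ f = t ^ g)%g -> stable t [set y | f y == g y].
  move=> E; apply/stableP => y; rewrite !inE -permJ -[g (t y)]permJ -E.
  by rewrite (inj_eq perm_inj).
apply/permP => y; apply/eqP.
have := bconn_any (x := r) (y := r) B (agree s Es) (stable_edge r (agree a Ea)) _ y.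
by rewrite !inE Er eqxx => ->.
Qed.

Lemma card_bridgeless_maps k :
  nlmaps k = num_bridgeless_classes k * k`!.
Proof.
rewrite /nlmaps /num_bridgeless_classes bridgeless_mapsE.
have conjM f g M : map_conj g (map_conj f M) = map_conj (f * g)%g M :> rmap k.
  by rewrite /map_conj /= !conjgM permM.
have conj1 M : map_conj 1%g M = M :> rmap k.
  by case: M => [[s a] r]; rewrite /map_conj /= !conjg1 perm1.
have eqR : {in lmaps [set: 'I_k] & &, equivalence_rel (@rmap_iso k)}.
  move=> M M' M'' _ _ _; split; first by apply/rmap_isoP; exists 1%g.
  move=> /rmap_isoP[f ->]; apply/rmap_isoP/rmap_isoP => -[g ->].
    by exists (f^-1 * g)%g; rewrite conjM mulKVg.
  by exists (f * g)%g; rewrite conjM.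
apply: (card_uniform_partition _ (equivalence_partitionP eqR)).
move=> _ /imsetP[M ML ->].
(* A class is an orbit under relabelling, and by rigidity distinct relabellings give distinct
   maps. *)
transitivity #|[set map_conj f M | f in [set: {perm 'I_k}]]|.
  apply: eq_card => M'; rewrite inE; apply/andP/imsetP => [[_ /rmap_isoP[f ->]]|[f _ ->]].
    by exists f.
  by split; [apply: lmaps_conj|apply/rmap_isoP; exists f].
by rewrite card_imset ?cardsT ?card_Sn //; apply: map_conj_inj.
Qed.

(** * Connected chord diagrams as involutions *)

(** Each crossing pair of chords has one presentation by its left endpoints [u] < [v]; together with
    [stable a A] these decide the whole chords. Fixed points of [a] never satisfy the
    inequalities. *)
Definition cross_stable m (a : {perm 'I_m}) (A : {set 'I_m}) :=
  [forall u : 'I_m, forall v : 'I_m,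
    [&& u < v, v < a u & a u < a v] ==> ((u \in A) == (v \in A))].

Lemma cross_stableP m (a : {perm 'I_m}) (A : {set 'I_m}) :
  reflect (forall u v : 'I_m, u < v -> v < a u -> a u < a v ->
             (u \in A) = (v \in A))
    (cross_stable a A).
Proof.
apply: (iffP forallP) => aA u.
  move=> v uv vau auav; have /forallP/(_ v) := aA u.
  by rewrite uv vau auav => /eqP.
apply/forallP => v; apply/implyP => /and3P[uv vau auav].
by rewrite (aA u v).
Qed.

Lemma cross_stableC m (a : {perm 'I_m}) (A : {set 'I_m}) :
  cross_stable a A -> cross_stable a (~: A).
Proof.
move/cross_stableP=> aA; apply/cross_stableP => u v uv vau auav.
by rewrite !inE (aA u v).
Qed.

(* A connected chord diagram with endpoint set [S], encoded by the involution
   that exchanges the endpoints of each chord and is the identity outside [S]. *)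
Record chords_on m (S : {set 'I_m}) (a : {perm 'I_m}) : Prop := ChordsOn {
  ch_on : perm_on S a;
  chK : forall y, a (a y) = y;
  ch_nofix : forall y, y \in S -> a y != y;
  ch_conn : forall y (A : {set 'I_m}), stable a A -> cross_stable a A ->
    y \in S -> y \in A -> S \subset A }.

Definition lchords m (S : {set 'I_m}) : {set {perm 'I_m}} :=
  [set a | [&& perm_on S a, [forall y, a (a y) == y],
    [forall y in S, a y != y] &
    [forall y in S, [forall A : {set 'I_m},
       stable a A ==> cross_stable a A ==> (y \in A) ==> (S \subset A)]]]].

Lemma lchordsP m (S : {set 'I_m}) a :
  reflect (chords_on S a) (a \in lchords S).
Proof.
rewrite inE; apply: (iffP and4P).
  case=> aS /forallP aK /forall_inP nf /forall_inP conn; split=> //.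
  - by move=> y; apply/eqP.
  - by move=> y A sA cA /conn/forallP/(_ A); rewrite sA cA /= => /implyP.
case=> aS aK nf conn; split=> //.
- by apply/forallP => y; rewrite aK.
- by apply/forall_inP.
apply/forall_inP => y yS; apply/forallP => A.
by apply/implyP => ?; apply/implyP => ?; apply/implyP => ?; apply: conn yS _.
Qed.

(** Connectivity need only be tested from one endpoint [p]: a closed set missing [p] has a closed
    complement containing it. *)
Lemma ch_conn_base m (S : {set 'I_m}) (a : {perm 'I_m}) p :
  p \in S -> (forall A : {set 'I_m}, stable a A -> cross_stable a A -> p \in A ->
    S \subset A) ->
  forall y (A : {set 'I_m}), stable a A -> cross_stable a A ->
    y \in S -> y \in A -> S \subset A.
Proof.
move=> pS base y A sA cA yS yA; have [pA|pA] := boolP (p \in A); first exact: base.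
have := base _ (stableC sA) (cross_stableC cA); rewrite inE pA => /(_ isT)/subsetP/(_ y yS).
by rewrite inE yA.
Qed.

Lemma lchords_ext m m' (f : 'I_m -> 'I_m') (fI : injective f) :
  (forall x y, (f x < f y) = (x < y)) ->
  lchords (f @: setT) = ext_perm fI @: lchords [set: 'I_m].
Proof.
move=> fM; apply/setP => p; apply/lchordsP/imsetP => [C|[a /lchordsP C ->]].
  have [a pa] := ext_perm_surj fI (ch_on C); subst p; exists a => //.
  apply/lchordsP; split.
  - by apply/subsetP => y; rewrite inE.
  - by move=> y; apply: (fI); rewrite -!(ext_permE fI) (chK C).
  - move=> y _; have := ch_nofix C (imset_f f (in_setT y)).
    by rewrite ext_permE (inj_eq fI).
  - move=> y A sA cA _ yA.
    have cA' : cross_stable (ext_perm fI a) (f @: A).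
      apply/cross_stableP => u v.
      have [/imsetP[u' _ ->]|uf] := boolP (u \in f @: setT); last first.
        by rewrite [ext_perm fI a u]ext_perm_out //; lia.
      have [/imsetP[v' _ ->]|vf] := boolP (v \in f @: setT); last first.
        by rewrite [ext_perm fI a v]ext_perm_out //; lia.
      rewrite !ext_permE !fM !mem_imset //; exact: (cross_stableP _ _ cA).
    have := ch_conn C (stable_ext_im fI sA) cA' (imset_f f (in_setT y)).
    rewrite mem_imset // => /(_ yA)/subsetP TA; apply/subsetP => z _.
    by rewrite -(mem_imset _ _ fI) TA ?imset_f ?inE.
split; first exact: ext_perm_on.
- move=> y; have [/imsetP[x _ ->]|yf] := boolP (y \in f @: setT).
    by rewrite !ext_permE (chK C).
  by rewrite !ext_perm_out // !ext_perm_out.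
- by move=> _ /imsetP[x _ ->]; rewrite ext_permE (inj_eq fI) (ch_nofix C) ?inE.
move=> _ A sA cA /imsetP[x _ ->] xA.
have cA' : cross_stable a (f @^-1: A).
  apply/cross_stableP => u v uv vau auav; rewrite !inE.
  by apply: (cross_stableP _ _ cA); rewrite ?ext_permE fM.
have := ch_conn C (stable_ext_preim sA) cA' (in_setT x).
rewrite inE xA => /(_ isT)/subsetP TA.
by apply/subsetP => _ /imsetP[y _ ->]; have := TA y; rewrite !inE => ->.
Qed.

Definition nlchords (k : nat) := #|lchords [set: 'I_k]|.

(** Relabelling a set of endpoints by its enumeration must preserve crossings, hence the order; the
    enumeration is a filter of an increasing sequence. *)
Lemma enum_val_ord_mono m (S : {set 'I_m}) (x y : 'I_#|S|) :
  (@enum_val _ (mem S) x < @enum_val _ (mem S) y) = (x < y).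
Proof.
have mono (u v : 'I_#|S|) : u < v -> @enum_val _ (mem S) u < @enum_val _ (mem S) v.
  move=> uv; have x0 : 'I_m by exact: (enum_val u).
  rewrite !(enum_val_nth x0).
  rewrite -!(nth_map _ 0 val) -?cardE //.
  apply: (sorted_ltn_nth ltn_trans); rewrite ?inE ?size_map -?cardE //.
  rewrite -[enum _](eq_filter (mem_enum _)) -(eq_filter (mem_map val_inj _)).
  rewrite -filter_map (sorted_filter ltn_trans) //.
  by rewrite unlock val_ord_enum iota_ltn_sorted.
case: (ltngtP x y) => [/mono->//|/mono|/val_inj->]; last by rewrite ltnn.
by move=> yx; rewrite ltnNge ltnW.
Qed.

Lemma card_lchords m (S : {set 'I_m}) : #|lchords S| = nlchords #|S|.
Proof.
rewrite /nlchords -(card_imset _ (@ext_perm_inj _ _ _ (@enum_val_inj _ (mem S)))).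
rewrite -lchords_ext; last exact: enum_val_ord_mono.
congr #|pred_of_set (lchords _)|; apply/setP => x; apply/idP/imsetP => [xH|[i _ ->]].
  by exists (enum_rank_in xH x); rewrite ?inE // enum_rankK_in.
exact: enum_valP.
Qed.

Lemma nlchords1 : nlchords 1 = 0.
Proof.
apply: eq_card0 => a; apply/negP => /lchordsP C.
have := ch_nofix C (in_setT ord0); have -> : a ord0 = ord0; last by rewrite eqxx.
by apply/val_inj; case: (a ord0) => -[].
Qed.

Lemma nlchords2 : nlchords 2 = 1.
Proof.
transitivity #|[set tperm (ord0 : 'I_2) ord_max]|; last by rewrite cards1.
apply: eq_card => a; rewrite [RHS]inE.
have T2 (x : 'I_2) : x = ord0 \/ x = ord_max.
  by case: x => -[|[|//]] lx; [left|right]; apply/val_inj.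
apply/lchordsP/eqP => [C|->].
  have a0 : a ord0 = ord_max.
    have := ch_nofix C (in_setT ord0).
    by case: (T2 (a ord0)) => ->.
  have a1 : a ord_max = ord0 by rewrite -a0 (chK C).
  by apply/permP => x; case: (T2 x) => ->; rewrite ?tpermL ?tpermR.
split.
- by apply/subsetP => y; rewrite inE.
- by move=> y; rewrite tpermK.
- by move=> y _; case: (T2 y) => ->; rewrite ?tpermL ?tpermR.
move=> y A /stableP sA _ _ yA; apply/subsetP => x _.
have : ord0 \in A /\ ord_max \in A.
  by have := sA ord0; rewrite tpermL; case: (T2 y) yA => -> ->.
by case: (T2 x) => -> [].
Qed.

(** * Removing the root chord *)

Lemma ord_neq_ltn m (u v : 'I_m) : (u != v) = (u < v) || (v < u).
Proof. by rewrite -val_eqE neq_ltn. Qed.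

Lemma card_ord_itv n a b : b <= n -> #|[set p : 'I_n | a <= p < b]| = b - a.
Proof.
move=> bn; rewrite -[RHS]muln1 -sum_nat_const_nat (big_nat_widen _ _ n) //.
rewrite (big_nat_widenl _ 0) // big_mkord -sum1_card; apply: eq_bigl => p.
by rewrite inE andbC.
Qed.

(* The endpoints that remain in the component of [1] once the root chord is
   removed; the complement consists of [0] and the gap between [i] and [j]. *)
Definition gapset m (i j : nat) : {set 'I_m.+1} :=
  [set p : 'I_m.+1 | (0 < p <= i) || (j <= p)].

Lemma card_gapset m i j : i < j <= m -> #|gapset m i j| = i + (m.+1 - j).
Proof.
case/andP=> ij jm.
have -> : gapset m i j = [set p : 'I_m.+1 | 1 <= p < i.+1] :|: [set p : 'I_m.+1 | j <= p < m.+1].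
  by apply/setP => p; rewrite !inE ltn_ord andbT ltnS.
rewrite cardsU !card_ord_itv //; last by lia.
rewrite (_ : _ :&: _ = set0) ?cards0 ?subn0 ?subn1 //.
by apply/setP => p; rewrite !inE; lia.
Qed.

Lemma card_gapsetC m i j : i < j <= m -> #|~: gapset m i j| = j - i.
Proof. by move=> ij; rewrite cardsCs setCK card_gapset // card_ord; lia. Qed.

Lemma cross_stableI m (a : {perm 'I_m}) (A B : {set 'I_m}) :
  cross_stable a A -> cross_stable a B -> cross_stable a (A :&: B).
Proof.
move=> /cross_stableP aA /cross_stableP aB; apply/cross_stableP => u v *.
by rewrite !inE (aA u v) // (aB u v).
Qed.

Lemma cross_supp m (S : {set 'I_m}) (a : {perm 'I_m}) (u v : 'I_m) :
  perm_on S a -> u < v -> v < a u -> a u < a v -> (u \in S) && (v \in S).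
Proof.
move=> aS uv vau auav; apply/andP; split; apply/negPn/negP => nS.
  by move: vau; rewrite (out_perm aS nS); lia.
by move: auav; rewrite (out_perm aS nS); lia.
Qed.

Lemma eq_on_closed m (S : {set 'I_m}) (a a1 : {perm 'I_m}) (A : {set 'I_m}) :
  perm_on S a1 -> {in S, a1 =1 a} -> stable a A -> cross_stable a A ->
  stable a1 A /\ cross_stable a1 A.
Proof.
move=> a1S E /stableP aA /cross_stableP cA; split.
  apply/stableP => y; have [yS|yS] := boolP (y \in S); first by rewrite E.
  by rewrite (out_perm a1S).
apply/cross_stableP => u v uv vau auav.
have /andP[uS vS] := cross_supp a1S uv vau auav.
by apply: cA => //; rewrite -!E.
Qed.

Lemma chord_glue m i j (a1 a2 : {perm 'I_m.+1}) : 0 < i -> i < j <= m ->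
  chords_on (gapset m i j) a1 -> chords_on (~: gapset m i j) a2 ->
  chords_on setT (a1 * a2)%g.
Proof.
move=> i0 /andP[ij jm] C1 C2; set S := gapset m i j in C1 C2.
have D : [disjoint S & ~: S] by rewrite disjoints_subset setCK.
have aE1 : {in S, a1 =1 (a1 * a2)%g}.
  by move=> y yS; rewrite (permMl (ch_on C1) (ch_on C2)) // inE negbK.
have aE2 : {in ~: S, a2 =1 (a1 * a2)%g}.
  by move=> y yS; rewrite (permMr _ (ch_on C1)) //; rewrite inE in yS.
have zS : (ord0 : 'I_m.+1) \in ~: S by rewrite !inE /=; lia.
split.
- by apply/subsetP => y; rewrite inE.
- move=> y; have [yS|yS] := boolP (y \in S).
    by rewrite -(aE1 y) // -aE1 ?(chK C1) // perm_closed ?(ch_on C1).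
  have {}yS : y \in ~: S by rewrite inE.
  by rewrite -(aE2 y) // -aE2 ?(chK C2) // perm_closed ?(ch_on C2).
- move=> y _; have [yS|yS] := boolP (y \in S).
    by rewrite -aE1 // (ch_nofix C1).
  have {}yS : y \in ~: S by rewrite inE.
  by rewrite -aE2 // (ch_nofix C2).
apply: (ch_conn_base (in_setT ord0)) => A sA cA zA.
have [s1 c1] := eq_on_closed (ch_on C1) aE1 sA cA.
have [s2 c2] := eq_on_closed (ch_on C2) aE2 sA cA.
have SCA := ch_conn C2 s2 c2 zS zA.
suff SA : S \subset A by rewrite -(setUCr S) subUset SA.
(* some chord of the first diagram spans the gap, hence crosses the root chord *)
have [u /andP[ui aui]] : exists u : 'I_m.+1, (0 < u <= i) && (j <= a1 u).
  apply/existsP; apply: contraT; rewrite negb_exists => /forallP nex.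
  have inS (u : 'I_m.+1) : 0 < u <= i -> 0 < a1 u <= i.
    move=> ui; have := nex u; rewrite ui /=.
    have : a1 u \in S by rewrite perm_closed ?(ch_on C1) // inE ui.
    by rewrite inE; clear; lia.
  have i1 : i < m.+1 by clear - ij jm; lia.
  (* Without a spanning chord, the part of [S] before the gap would be a union of components,
     although it contains [i] and misses the last endpoint. *)
  pose L := [set p : 'I_m.+1 | 0 < p <= i].
  have sL : stable a1 L.
    by apply: stable_inv => [y|y]; [exact: (chK C1)|rewrite !inE; exact: inS].
  have cL : cross_stable a1 L.
    apply/cross_stableP => u v uv vau auav.
    have /andP[uS vS] := cross_supp (ch_on C1) uv vau auav.
    rewrite inE in uS; rewrite !inE; apply/idP/idP => [/inS h|h].
      by clear - h uv vau; lia.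
    by clear - h uv uS ij; lia.
  have iS : Ordinal i1 \in S by rewrite inE /= i0 leqnn.
  have iL : Ordinal i1 \in L by rewrite inE /= i0 leqnn.
  have /subsetP/(_ ord_max) := ch_conn C1 sL cL iS iL.
  by rewrite !inE /=; clear - ij jm; lia.
have uS : u \in S by rewrite inE ui.
have bS : a2 ord0 \in ~: S by rewrite perm_closed ?(ch_on C2).
have b0 := ch_nofix C2 zS.
apply: (ch_conn C1 s1 c1 uS).
rewrite -(cross_stableP _ _ cA ord0 u) -?(aE2 _ zS) -?(aE1 _ uS) //=.
- by clear - ui; lia.
- by move: bS b0; rewrite !inE ord_neq_ltn /=; clear - ui; lia.
- by move: bS; rewrite !inE; clear - aui; lia.
Qed.

(** The root chord is deleted by fixing its two endpoints, which keeps the ground set unchanged. *)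
Definition unroot m (a : {perm 'I_m.+1}) : {perm 'I_m.+1} := (tperm ord0 (a ord0) * a)%g.

Lemma unrootE m (a : {perm 'I_m.+1}) y :
  (forall z, a (a z) = z) ->
  unroot a y = if y \in [set ord0; a ord0] then y else a y.
Proof.
move=> aK; rewrite permM !inE; case: tpermP => [->|->|]; rewrite ?eqxx ?orbT ?aK //.
by move=> /eqP/negPf-> /eqP/negPf->.
Qed.

(** Every chord outside the set other than the root chord lies inside the gap, between two
    consecutive points of the set, so it crosses no chord of the set. *)
Lemma gapset_closed m i j (a : {perm 'I_m.+1}) : 0 < i -> i < j ->
  (forall z, a (a z) = z) -> stable a (gapset m i j) ->
  stable (unroot a) (gapset m i j) /\ cross_stable (unroot a) (gapset m i j).
Proof.
move=> i0 ij aK /stableP aS; split.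
  by apply/stableP => y; rewrite unrootE //; case: ifP.
apply/cross_stableP => u v; rewrite !unrootE //.
case: ifP => uR; first by lia.
case: ifP => vR; first by lia.
have au0 : a u != ord0 by apply: contraFneq uR => E; rewrite !inE -E aK eqxx orbT.
have av0 : a v != ord0 by apply: contraFneq vR => E; rewrite !inE -E aK eqxx orbT.
move: uR vR au0 av0; rewrite !inE -!val_eqE /= => /norP[u0 _] /norP[v0 _].
have := aS u; have := aS v; rewrite !inE; clear - ij u0 v0; lia.
Qed.

Lemma first_component m i j (a1 a2 : {perm 'I_m.+1}) (A : {set 'I_m.+1}) :
  0 < i -> i < j <= m ->
  chords_on (gapset m i j) a1 -> chords_on (~: gapset m i j) a2 ->
  stable (unroot (a1 * a2)%g) A -> cross_stable (unroot (a1 * a2)%g) A ->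
  inord 1 \in A -> gapset m i j \subset A.
Proof.
move=> i0 ijm C1 C2 sA cA oneA; have C := chord_glue i0 ijm C1 C2.
case/andP: ijm => ij jm.
have D : [disjoint gapset m i j & ~: gapset m i j] by rewrite disjoints_subset setCK.
have E1 : {in gapset m i j, a1 =1 unroot (a1 * a2)%g}.
  move=> y yS; have aE z : z \in gapset m i j -> (a1 * a2)%g z = a1 z.
    by move=> zS; rewrite (permMl (ch_on C1) (ch_on C2)) // inE negbK.
  rewrite (unrootE _ (chK C)) -aE //; case: ifP => //.
  have zS : (ord0 : 'I_m.+1) \notin gapset m i j by rewrite inE /=; clear - ij; lia.
  rewrite !inE => /orP[]/eqP yE; first by rewrite yE (negPf zS) in yS.
  have : a1 y \in gapset m i j by rewrite perm_closed ?(ch_on C1).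
  by rewrite -aE // yE (chK C) (negPf zS).
have [s1 c1] := eq_on_closed (ch_on C1) E1 sA cA.
apply: (ch_conn C1 s1 c1 (y := inord 1)) => //.
by rewrite inE inordK; clear - i0 ij jm; lia.
Qed.

(** The common point [b] of both gaps will be the far end of the root chord: [i] and [j] are its
    nearest neighbours in the set. *)
Lemma gapset_inj m i j i' j' b : i < b < j -> i' < b < j' ->
  j <= m -> j' <= m -> gapset m i j = gapset m i' j' -> i = i' /\ j = j'.
Proof.
move=> ib ib' jm jm' /setP E.
have memE p : p <= m -> ((0 < p <= i) || (j <= p)) = ((0 < p <= i') || (j' <= p)).
  by move=> pm; have := E (inord p); rewrite !inE inordK.
split; apply/eqP; rewrite eqn_leq; apply/andP; split.
- by case: i ib E memE => // i ib _ /(_ i.+1); lia.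
- by case: i' ib' E memE => // i' ib' _ /(_ i'.+1); lia.
- by have := memE j' jm'; lia.
- by have := memE j jm; lia.
Qed.

(** Each gap set is closed once the root chord is gone and contains 1, so by [first_component] each
    contains the other; restriction then recovers the two factors. *)
Lemma chord_glue_inj m i j i' j' (a1 a2 b1 b2 : {perm 'I_m.+1}) :
  0 < i -> i < j <= m -> 0 < i' -> i' < j' <= m ->
  chords_on (gapset m i j) a1 -> chords_on (~: gapset m i j) a2 ->
  chords_on (gapset m i' j') b1 -> chords_on (~: gapset m i' j') b2 ->
  (a1 * a2 = b1 * b2)%g -> [/\ i = i', j = j', a1 = b1 & a2 = b2].
Proof.
move=> i0 ijm i0' ijm' A1 A2 B1 B2 E.
have [ij jm] := andP ijm; have [ij' jm'] := andP ijm'.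
have closed k l (c1 c2 : {perm 'I_m.+1}) : 0 < k -> k < l <= m ->
    chords_on (gapset m k l) c1 -> chords_on (~: gapset m k l) c2 ->
    [/\ stable (unroot (c1 * c2)%g) (gapset m k l),
      cross_stable (unroot (c1 * c2)%g) (gapset m k l),
      inord 1 \in gapset m k l & k < (c1 * c2)%g ord0 < l].
  move=> k0 klm C1 C2; have [kl lm] := andP klm.
  have st : stable (c1 * c2)%g (gapset m k l).
    apply: stableM; first exact: perm_on_stable (ch_on C1).
    by rewrite -[gapset m k l]setCK; apply/stableC/perm_on_stable/(ch_on C2).
  have C := chord_glue k0 klm C1 C2.
  have [? ?] := gapset_closed k0 kl (chK C) st; split=> //.
    by rewrite inE inordK; clear - k0 klm; lia.
  have := ch_nofix C (in_setT ord0); have := stableP _ _ st ord0.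
  by rewrite !inE ord_neq_ltn /=; clear - k0 klm; lia.
have [sA cA oA bA] := closed _ _ _ _ i0 ijm A1 A2.
have [sB cB oB bB] := closed _ _ _ _ i0' ijm' B1 B2.
have ES : gapset m i j = gapset m i' j'.
  apply/eqP; rewrite eqEsubset; apply/andP; split.
    by apply: (first_component i0 ijm A1 A2); rewrite ?E.
  by apply: (first_component i0' ijm' B1 B2); rewrite -?E.
rewrite -E in bB.
have [ii jj] := gapset_inj bA bB jm jm' ES; subst i' j'.
have D : [disjoint gapset m i j & ~: gapset m i j] by rewrite disjoints_subset setCK.
by have [-> ->] := perm_on_mul_inj D (ch_on A1) (ch_on A2) (ch_on B1) (ch_on B2) E.
Qed.

(** The component is a closed set of least size containing [p]; intersecting it with another closed
    set through [p] cannot make it smaller. *)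
Lemma unroot_component m (a : {perm 'I_m.+1}) (p : 'I_m.+1) : exists S : {set 'I_m.+1},
  [/\ p \in S, stable (unroot a) S, cross_stable (unroot a) S &
   forall y (A : {set 'I_m.+1}), stable (unroot a) A -> cross_stable (unroot a) A ->
     y \in S -> y \in A -> S \subset A].
Proof.
pose Q (A : {set 'I_m.+1}) :=
  [&& stable (unroot a) A, cross_stable (unroot a) A & p \in A].
have Q0 : Q setT.
  apply/and3P; split; rewrite ?inE //; first by apply/stableP => y; rewrite !inE.
  by apply/cross_stableP => u v _ _ _; rewrite !inE.
case: (@arg_minnP _ setT Q (fun A => #|A|) Q0) => S /and3P[sS cS pS] Smin.
exists S; split=> //; apply: (ch_conn_base pS) => A sA cA pA.
have /Smin SA : Q (S :&: A) by rewrite /Q stableI ?cross_stableI // inE pS.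
by apply/setIidPl/eqP; rewrite eqEcard subsetIl SA.
Qed.

Lemma chord_unglue m (a : {perm 'I_m.+1}) : 1 < m -> chords_on setT a ->
  exists i j, [/\ 0 < i, i < j <= m, stable a (gapset m i j),
    chords_on (gapset m i j) (restr_perm (gapset m i j) a) &
    chords_on (~: gapset m i j) (restr_perm (~: gapset m i j) a)].
Proof.
move=> m1 C; have aK := chK C.
have conn y (A : {set 'I_m.+1}) : stable a A -> cross_stable a A -> y \in A -> ord0 \in A.
  by move=> sA cA yA; rewrite (subsetP (ch_conn C sA cA (in_setT y) yA)) ?inE.
have conn0 y (A : {set 'I_m.+1}) : stable a A -> cross_stable a A -> ord0 \in A -> y \in A.
  by move=> sA cA yA; rewrite (subsetP (ch_conn C sA cA (in_setT ord0) yA)) ?inE.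
have [b bE] : exists b, a ord0 = b by exists (a ord0).
have ab : a b = ord0 by rewrite -bE aK.
have b0 : 0 < b.
  by have := ch_nofix C (in_setT ord0); rewrite bE ord_neq_ltn /=; clear; lia.
have ltb0 (u v : 'I_m.+1) : u < v -> v < a u -> a u < a v -> [/\ u != b, v != b & v != ord0].
  move=> uv vau auav; split; apply/eqP => E; move: uv vau auav; rewrite E ?ab /=; clear; lia.
(* A root chord joining 0 and 1 would cross nothing, and 2 would be unreachable. *)
have b1 : 1 < b.
  rewrite ltnNge; apply/negP => bl.
  have b1 : b = 1 :> nat by clear - bl b0; lia.
  have : inord 2 \in [set ord0; b].
    apply: conn0; last by rewrite !inE eqxx.
      by apply: stable_inv => // y; rewrite !inE => /orP[]/eqP->; rewrite ?bE ?ab eqxx ?orbT.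
    apply/cross_stableP => u v uv vau auav; have [ub vb v0] := ltb0 u v uv vau auav.
    rewrite !inE (negPf ub) (negPf vb) (negPf v0) orbF.
    apply/negbTE/eqP => u0; move: uv vau; rewrite u0 bE b1 /=; clear; lia.
  by rewrite !inE -!val_eqE /= inordK ?b1.
have uE y : unroot a y = if (y == ord0) || (y == b) then y else a y.
  by rewrite unrootE // !inE bE.
have uEn y : y != ord0 -> y != b -> unroot a y = a y.
  by move=> y0 yb; rewrite uE (negPf y0) (negPf yb).
have [S [oS sS cS comp]] := unroot_component a (inord 1 : 'I_m.+1).
have o1 : (inord 1 : 'I_m.+1) = 1 :> nat by rewrite inordK //; clear - m1; lia.
have SR : S \subset ~: [set ord0; b].
  apply: (comp (inord 1)) => //.
  - apply/stableP => y; rewrite uE; case: ifP => // /norP[y0 yb].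
    rewrite !inE (negPf y0) (negPf yb) -{1}ab -{2}bE !(inj_eq perm_inj).
    by rewrite (negPf y0) (negPf yb).
  - apply/cross_stableP => u v; rewrite !uE.
    case: ifP => uR; first by clear; lia.
    case: ifP => vR; first by clear; lia.
    by rewrite !inE uR vR.
  - by rewrite !inE -!val_eqE /= o1; clear - b1; lia.
have SE y : y \in S -> [/\ y != ord0, y != b & unroot a y = a y].
  move=> yS; have := subsetP SR y yS; rewrite !inE negb_or => /andP[y0 yb].
  by rewrite uEn.
have zS : ord0 \notin S by apply/negP => /SE[]; rewrite eqxx.
have bS : b \notin S by apply/negP => /SE[_]; rewrite eqxx.
have aS : stable a S.
  apply: stable_inv => // y yS; have [_ _ <-] := SE y yS.
  by rewrite (stableP _ _ sS).
have aSE y : (a y \in S) = (y \in S) by rewrite (stableP _ _ aS).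
have aSC := stableC aS.
have crossS (u v : 'I_m.+1) : u < v -> v < a u -> a u < a v -> u != ord0 ->
    (u \in S) = (v \in S).
  move=> uv vau auav u0; have [ub vb v0] := ltb0 u v uv vau auav.
  by apply: (cross_stableP _ _ cS) => //; rewrite !uEn.
(* otherwise the part of S below the chord of p would be a union of components,
   hence all of S, although 1 is in S *)
have nest (p s : 'I_m.+1) : p \notin S -> p != ord0 -> s \in S -> p < s -> s < a p -> False.
  move=> pS p0 sS' ps sap.
  have pap : p < a p by clear - ps sap; lia.
  have pb : p != b by apply: contraTneq pap => ->; rewrite ab -leqNgt.
  have neqS q : q \in S -> [/\ (q : nat) != p & (q : nat) != a p].
    move=> qS; split; apply: contraNneq pS => /val_inj E; first by rewrite -E.
    by rewrite -aSE -E.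
  have stA : stable (unroot a) (S :&: [set q : 'I_m.+1 | p < q < a p]).
    apply: stable_inv => [q|q].
      rewrite (uE q); case: ifP => qR; first by rewrite uE qR.
      case/norP: qR => q0 qb; rewrite uEn ?aK //.
        by rewrite -{1}ab (inj_eq perm_inj).
      by rewrite -{1}bE (inj_eq perm_inj).
    rewrite !inE => /andP[qS pq]; have [_ _ ->] := SE q qS.
    rewrite aSE qS /=; have aqS : a q \in S by rewrite aSE.
    have [n1 n2] := neqS _ aqS.
    have [lt1|ge1] := ltnP (a q) p.
      have := crossS (a q) p lt1; rewrite aK (negPf pS) aqS.
      have [aq0 _ _] := SE _ aqS.
      by case/andP: pq => pq qap /(_ pq qap aq0).
    have [lt2|ge2] := ltnP (a p) (a q).
      have := crossS p q; rewrite (negPf pS) qS.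
      by case/andP: pq => pq qap /(_ pq qap lt2 p0).
    by clear - n1 n2 ge1 ge2; lia.
  have cA : cross_stable (unroot a) (S :&: [set q : 'I_m.+1 | p < q < a p]).
    apply/cross_stableP => u v uv vau auav; have uvS := cross_stableP _ _ cS u v uv vau auav.
    apply/idP/idP => h; move: (h); rewrite -(stableP _ _ stA).
      move: h; rewrite !inE uvS => /andP[-> /= h1] /andP[_ h2].
      by clear - h1 h2 uv vau; lia.
    move: h; rewrite inE => /andP[vS h1]; rewrite inE => /andP[_ h2].
    rewrite -(stableP _ _ stA) !inE (stableP _ _ sS) uvS vS.
    by move: h1 h2; rewrite !inE; clear - uv vau auav; lia.
  have sA : s \in S :&: [set q : 'I_m.+1 | p < q < a p] by rewrite !inE sS' ps.
  have /subsetP/(_ _ oS) := comp s _ stA cA sS' sA.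
  rewrite !inE o1 => /andP[_]; move: p0; rewrite -val_eqE /=; clear; lia.
(* [sep y s] says that [s] lies strictly between [y] and [b]. So [A] collects the endpoints outside
   [S], other than 0, that are not in the gap of [S] around [b]. *)
pose sep (y s : 'I_m.+1) := (y < s < b) || (b < s < y).
pose A := [set y | [&& y \notin S, y != ord0 & [exists s in S, sep y s]]].
have zA : ord0 \notin A by rewrite inE eqxx andbF.
have bA : b \notin A.
  by rewrite inE; apply/and3P => -[_ _ /exists_inP[s _]]; rewrite /sep; clear; lia.
(* By [nest] no chord counted here encloses a point of [S], so [A] is closed in the whole diagram,
   root chord included. As it misses 0, it is empty. *)
have Aempty y : y \notin A.
  apply/negP => yA; have := zA; rewrite (conn y) //.
    apply: stable_inv => // {yA}y yA; have yb : y != b by apply: contraTneq yA => ->.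
    move: yA; rewrite !inE => /and3P[yS y0 /exists_inP[s sS' sy]].
    have ay0 : a y != ord0 by rewrite -{1}ab (inj_eq perm_inj).
    rewrite aSE yS ay0; apply/exists_inP; exists s => //.
    have n1 := nest y s yS y0 sS'; have n2 := nest (a y) s _ ay0 sS'.
    rewrite aSE aK in n2; have {}n2 := n2 yS.
    have n3 : (s : nat) != a y by apply: contraNneq yS => /val_inj E; rewrite -aSE -E.
    by move: sy; rewrite /sep; clear - n1 n2 n3; lia.
  apply/cross_stableP => u v uv vau auav; have [ub vb v0] := ltb0 u v uv vau auav.
  have [u0|u0] := eqVneq u ord0.
    rewrite u0 (negPf zA); apply/esym/negbTE; rewrite inE.
    apply/and3P => -[vS _ /exists_inP[s sS']]; rewrite /sep.
    have n1 := nest v s vS v0 sS'; rewrite u0 bE in vau auav.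
    by clear - n1 vau auav; lia.
  have uvS := crossS u v uv vau auav u0.
  rewrite !inE u0 v0 uvS /=; case: (boolP (v \in S)) => //= vS.
  have uS : u \notin S by rewrite uvS.
  apply: eq_existsb => s; case: (boolP (s \in S)) => //= sS'.
  have n1 := nest u s uS u0 sS'; have n2 := nest v s vS v0 sS'.
  have n3 : (s : nat) != u by apply: contraNneq uS => /val_inj <-.
  by rewrite /sep; clear - n1 n2 n3 uv vau auav; lia.
have nsep y s : y \notin S -> y != ord0 -> s \in S -> ~~ sep y s.
  move=> yS y0 sS'; have := Aempty y; rewrite inE yS y0 /=; apply: contra => ys.
  by apply/exists_inP; exists s.
(* If [S] ended before [b], the root chord would cross none of its chords, and [S] would be closed
   without containing 0. *)
have [w wS bw] : exists2 w : 'I_m.+1, w \in S & b < w.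
  apply/exists_inP; apply: contraT => /exists_inPn nw.
  suff : ord0 \in S by rewrite (negPf zS).
  apply: (conn (inord 1)) => //; apply/cross_stableP => u v uv vau auav.
  have [u0|u0] := eqVneq u ord0; last exact: crossS.
  rewrite u0 (negPf zS); apply/esym/negbTE; rewrite -aSE; apply/negP => /nw.
  by rewrite u0 bE in auav; rewrite auav.
have oP : ((inord 1 : 'I_m.+1) \in S) && ((inord 1 : 'I_m.+1) < b) by rewrite oS o1 b1.
have wP : (w \in S) && (b < w) by rewrite wS.
have [i /andP[iS ib] imax] := @arg_maxnP _ (inord 1) (fun s => (s \in S) && (s < b)) val oP.
have [j /andP[jS bj] jmin] := @arg_minnP _ w (fun s => (s \in S) && (b < s)) val wP.
have ES : gapset m i j = S.
  apply/setP => p; rewrite inE; apply/idP/idP => [pij|pS].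
    apply/negPn/negP => pS.
    have p0 : p != ord0 by rewrite -val_eqE /=; clear - pij ib bj; lia.
    have n1 : (p : nat) != i by apply: contraNneq pS => /val_inj ->.
    have n2 : (p : nat) != j by apply: contraNneq pS => /val_inj ->.
    have := nsep p i pS p0 iS; have := nsep p j pS p0 jS; rewrite /sep.
    by clear - n1 n2 pij ib bj; lia.
  have [p0 pb _] := SE p pS; rewrite -val_eqE /= in p0; rewrite ord_neq_ltn in pb.
  case/orP: pb => pb.
    by have := imax p; rewrite pS pb /= => /(_ isT); clear - p0; lia.
  by have := jmin p; rewrite pS pb /= => /(_ isT) ->; rewrite orbT.
exists i, j; rewrite ES; split=> //.
- by have := imax _ oP; rewrite /= o1; clear; lia.
- by have := ltn_ord j; clear - ib bj; lia.
- split; first exact: restr_perm_on.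
  + move=> y; rewrite (restr_permP y aS); case: ifP => yS.
      by rewrite (restr_permP _ aS) aSE yS aK.
    by rewrite (restr_permP _ aS) yS.
  + by move=> y yS; rewrite restr_permP // yS (ch_nofix C) ?inE.
  + move=> y B sB cB yS yB.
    have sBS : stable (unroot a) (B :&: S).
      apply/stableP => q; rewrite !inE (stableP _ _ sS).
      have [qS|] := boolP (q \in S); last by rewrite !andbF.
      by have [_ _ ->] := SE q qS; rewrite -(stableP _ _ sB q) restr_permP // qS.
    have cBS : cross_stable (unroot a) (B :&: S).
      apply/cross_stableP => u v uv vau auav.
      have uvS := cross_stableP _ _ cS u v uv vau auav.
      rewrite !inE uvS; have [vS|] := boolP (v \in S); last by rewrite !andbF.
      rewrite vS in uvS; rewrite !andbT; apply: (cross_stableP _ _ cB) => //.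
        by rewrite restr_permP // uvS; have [_ _ <-] := SE u uvS.
      rewrite !restr_permP // uvS vS.
      by have [_ _ <-] := SE u uvS; have [_ _ <-] := SE v vS.
    have yBS : y \in B :&: S by rewrite inE yB.
    exact: subset_trans (comp y _ sBS cBS yS yBS) (subsetIl _ _).
- split; first exact: restr_perm_on.
  + move=> y; rewrite (restr_permP y aSC); case: ifP => yS.
      by rewrite (restr_permP _ aSC) (stableP _ _ aSC) yS aK.
    by rewrite (restr_permP _ aSC) yS.
  + by move=> y yS; rewrite restr_permP // yS (ch_nofix C) ?inE.
  have zSC : ord0 \in ~: S by rewrite inE.
  apply: (ch_conn_base zSC) => B sB cB zB.
  apply/subsetP => y yS.
  (* With all of [S] added, the only new crossings are those of the root chord with [S], and 0 is in
     [B]. *)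
  suff : y \in B :&: ~: S :|: S.
    by rewrite inE in_setI yS andbT => /orP[//|]; rewrite inE in yS; rewrite (negPf yS).
  apply: conn0; last by rewrite in_setU in_setI zB zSC.
    by apply: stableU => //; apply: stable_restrI.
  apply/cross_stableP => u v uv vau auav.
  have [u0|u0] := eqVneq u ord0.
    rewrite u0 !in_setU !in_setI zB zSC orTb.
    have [vS|vS] := boolP (v \in S); first by rewrite orbT.
    have vSC : v \in ~: S by rewrite inE.
    rewrite vSC andbT orbF; apply/esym; rewrite -(cross_stableP _ _ cB ord0 v) //.
    - by rewrite u0 in uv.
    - by rewrite restr_permP // zSC -u0.
    - by rewrite !restr_permP // zSC vSC -u0.
  have uvS := crossS u v uv vau auav u0.
  rewrite !in_setU !in_setI uvS; case: (boolP (v \in S)) => vS; first by rewrite !orbT.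
  have vSC : v \in ~: S by rewrite inE.
  have uSC : u \in ~: S by rewrite inE uvS.
  rewrite uSC vSC !andbT !orbF; apply: (cross_stableP _ _ cB) => //.
    by rewrite restr_permP // uSC.
  by rewrite !restr_permP // uSC vSC.
Qed.

(** * Counting chord diagrams *)

Lemma nlchords_rec m : 1 < m ->
  nlchords m.+1 = \sum_(t < m) t * nlchords t.+1 * nlchords (m - t).
Proof.
(* The component has t + 1 endpoints and the gap follows the i-th of them, whence t choices of i.
   The other m - t points are 0 and those in the gap, so the gap ends at i + (m - t). *)
move=> m1; pose ok (p : 'I_m * 'I_m) := 0 < p.2 <= p.1.
pose S (p : 'I_m * 'I_m) := gapset m p.2 (p.2 + (m - p.1)).
have okP p : ok p -> 0 < p.2 /\ p.2 < p.2 + (m - p.1) <= m.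
  by case: p => t i; rewrite /ok /=; have := ltn_ord t; lia.
pose D p := setX (lchords (S p)) (lchords (~: S p)).
pose Q := [set q : ('I_m * 'I_m) * ({perm 'I_m.+1} * {perm 'I_m.+1}) |
  ok q.1 && (q.2 \in D q.1)].
pose glue (q : ('I_m * 'I_m) * ({perm 'I_m.+1} * {perm 'I_m.+1})) :=
  (q.2.1 * q.2.2)%g.
have QP p a1 a2 : reflect [/\ ok p, chords_on (S p) a1 & chords_on (~: S p) a2]
    ((p, (a1, a2)) \in Q).
  rewrite inE in_setX /=; apply: (iffP and3P) => -[okp].
    by move=> /lchordsP C1 /lchordsP C2.
  by move=> /lchordsP C1 /lchordsP C2.
rewrite /nlchords; have -> : lchords [set: 'I_m.+1] = glue @: Q.
  apply/setP => a; apply/lchordsP/imsetP => [C|[[p [a1 a2]]]]; last first.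
    by move=> /QP[/okP[i0 ij] C1 C2] ->; apply: chord_glue C1 C2.
  have [i [j [i0 ijm aS C1 C2]]] := chord_unglue m1 C.
  have im : i < m by clear - ijm; lia.
  have tm : i + m - j < m by clear - ijm; lia.
  pose p := (Ordinal tm, Ordinal im).
  have pS : S p = gapset m i j by congr gapset; rewrite /=; clear - ijm; lia.
  exists (p, (restr_perm (S p) a, restr_perm (~: S p) a)).
    by apply/QP; rewrite pS; split=> //; rewrite /ok /=; clear - ijm i0; lia.
  rewrite /glue pS /=; apply/permP => y; rewrite permM (restr_permP y aS).
  by case: ifP => yS; rewrite (restr_permP _ (stableC aS)) in_setC ?(stableP _ _ aS) yS.
rewrite card_in_imset; last first.
  move=> [p [a1 a2]] [q [b1 b2]] /QP[/okP[i0 ij] A1 A2] /QP[/okP[i0' ij'] B1 B2] E.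
  have [E1 E2 -> ->] := chord_glue_inj i0 ij i0' ij' A1 A2 B1 B2 E.
  case: p q E1 E2 {E i0 ij i0' ij' A1 A2 B1 B2} => [t i] [t' i'] /= /val_inj-> E2.
  congr (_, _, _); apply/val_inj => /=; have := ltn_ord t; have := ltn_ord t'.
  by move: E2; clear; lia.
rewrite -sum1_card.
transitivity (\sum_(p | ok p) \sum_(q in D p) 1).
  by rewrite pair_big_dep; apply: eq_bigl => q; rewrite inE.
transitivity (\sum_(p | ok p) nlchords p.1.+1 * nlchords (m - p.1)).
  apply: eq_bigr => -[t i] /okP[/= i0 ij]; rewrite sum1_card cardsX !card_lchords.
  rewrite card_gapset // card_gapsetC // addKn; congr (nlchords _ * _).
  by have := ltn_ord t; move: ij; clear; rewrite /=; lia.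
transitivity (\sum_(t : 'I_m) \sum_(i : 'I_m | 0 < i <= t)
    nlchords t.+1 * nlchords (m - t)).
  by rewrite pair_big_dep.
apply: eq_bigr => t _; rewrite sum_nat_const mulnA; congr (_ * _ * _).
transitivity #|[set i : 'I_m | 1 <= i < t.+1]|; last by rewrite card_ord_itv ?subn1.
by apply: eq_card => i; rewrite inE.
Qed.

(** The identity is proved for all [N], so parity never enters the induction. The shift by one
    arises because the root edge has one half-edge while its chord has two endpoints. *)
Lemma nlmaps_nlchords N : nlmaps N = N`! * nlchords N.+1.
Proof.
elim/ltn_ind: N => -[|[|N]] IH; first by rewrite nlmaps0 nlchords1.
  by rewrite nlmaps1 nlchords2.
set M := N.+2 in IH *.
rewrite nlmaps_rec // nlchords_rec // big_distrr /=; apply: eq_bigr => j _.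
have jM := ltn_ord j; rewrite !IH //; last by rewrite /M; lia.
have -> : (M.-1 - j).+1 = M - j by rewrite /M in jM *; lia.
have F : (M - j)`! = (M - j) * (M.-1 - j)`!.
  by rewrite (_ : M - j = (M.-1 - j).+1) ?factS //; rewrite /M in jM *; lia.
rewrite -(bin_fact (ltnW jM)) F.
move: 'C(M, j) (M - j) (M.-1 - j)`! j`! (nlchords j.+1) => c d e f g.
by move: (nlchords d) (nat_of_ord j) => k l; lia.
Qed.

(** * Perfect matchings as fixed-point-free involutions *)

Lemma porbits_matching m (a : {perm 'I_m}) : chords_on setT a ->
  perfect_matching (porbits a).
Proof.
move=> C; have aK := chK C; apply/andP; split.
  apply/and3P; split.
  - rewrite eqEsubset subsetT; apply/subsetP => y _; apply/bigcupP.
    by exists (porbit a y); rewrite ?imset_f ?porbit_id ?inE.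
  - apply/trivIsetP => _ _ /imsetP[x _ ->] /imsetP[y _ ->] xy.
    apply/pred0P => z; apply: contraNF xy => /andP[] /=.
    by rewrite -!eq_porbit_mem => /eqP<-.
  - apply/negP => /imsetP[x _ /setP/(_ x)].
    by rewrite porbit_id inE.
apply/forall_inP => _ /imsetP[x _ ->].
have -> : porbit a x = [set x; a x] by apply/setP => y; rewrite porbit_involution.
by rewrite cards2 [x == _]eq_sym (ch_nofix C) ?inE.
Qed.

Lemma porbits_connected m (a : {perm 'I_m}) : (forall y, a (a y) = y) ->
  (diagram_connected (porbits a) <->
   forall y (A : {set 'I_m}), stable a A -> cross_stable a A ->
     y \in A -> A = setT).
Proof.
move=> aK; have inP y : porbit a y \in porbits a by apply: imset_f; rewrite inE.
have chordE (C : {set 'I_m}) (u v : 'I_m) : C \in porbits a -> u < v -> C = [set u; v] ->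
    C = porbit a u /\ v = a u.
  move=> /imsetP[z _ ->] uv E.
  have : u \in porbit a z by rewrite E !inE eqxx.
  rewrite -eq_porbit_mem => /eqP Eu; split=> //.
  have : v \in porbit a u by rewrite Eu E !inE eqxx orbT.
  rewrite porbit_involution // !inE => /orP[]/eqP// vu.
  by rewrite vu ltnn in uv.
split=> [/forall_inP conn y A sA cA yA|conn].
  apply/setP => z; rewrite inE -(porbit_sub_stable z sA).
  have /forall_inP/(_ _ (inP z)) yz := conn _ (inP y).
  suff /closed_connect/(_ _ _ yz) : closed (cross_rel (porbits a))
      [pred u : {set 'I_m} | u \subset A].
    by rewrite !inE porbit_sub_stable // yA => <-.
  move=> C D /and3P[CP DP /existsP[u /existsP[v /existsP[c /existsP[d]]]]].
  case/and3P=> /eqP EC /eqP ED; rewrite !inE.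
  case/orP => /andP[/andP[l1 l2] l3].
    have [-> vE] := chordE C u v CP (ltn_trans l1 l2) EC.
    have [-> dE] := chordE D c d DP (ltn_trans l2 l3) ED.
    rewrite !porbit_sub_stable //; apply: (cross_stableP _ _ cA) => //; by rewrite -vE -?dE.
  have [-> vE] := chordE C u v CP (ltn_trans l2 l3) EC.
  have [-> dE] := chordE D c d DP (ltn_trans l1 l2) ED.
  rewrite !porbit_sub_stable //; apply/esym; apply: (cross_stableP _ _ cA) => //.
    by rewrite -dE.
  by rewrite -vE -dE.
apply/forall_inP => _ /imsetP[y _ ->]; apply/forall_inP => _ /imsetP[z _ ->].
suff /setP/(_ z) : [set w | connect (cross_rel (porbits a)) (porbit a y) (porbit a w)]
    = [set: 'I_m] by rewrite !inE.
have pE (w : 'I_m) : porbit a w = [set w; a w].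
  by apply/setP => x; rewrite porbit_involution.
apply: (conn y); last by rewrite inE connect0.
  by apply/stableP => w; rewrite !inE (porbit_perm a 1).
apply/cross_stableP => u v uv vau auav; rewrite !inE; apply/idP/idP => c.
  apply: (connect_trans c (connect1 _)); apply/and3P; split=> //.
  apply/existsP; exists u; apply/existsP; exists (a u).
  apply/existsP; exists v; apply/existsP; exists (a v).
  by rewrite !pE !eqxx uv vau auav.
apply: (connect_trans c (connect1 _)); apply/and3P; split=> //.
apply/existsP; exists v; apply/existsP; exists (a v).
apply/existsP; exists u; apply/existsP; exists (a u).
by rewrite !pE !eqxx uv vau auav orbT.
Qed.

Lemma matching_involution m (P : {set {set 'I_m}}) : perfect_matching P ->
  exists a : {perm 'I_m}, [/\ forall y, a (a y) = y, forall y, a y != y &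
    P = porbits a].
Proof.
case/andP=> partP /forall_inP card2; have [/eqP covP trivP _] := and3P partP.
have inP y : y \in cover P by rewrite covP inE.
have blockP y : pblock P y \in P by rewrite pblock_mem.
(* The partner of [y] in its block; the default is never reached, since a block has two elements. *)
pose f y := odflt y [pick z in pblock P y :\ y].
have fP y : f y != y /\ pblock P y = [set y; f y].
  have := cardsD1 y (pblock P y); rewrite (eqP (card2 _ (blockP y))) mem_pblock inP.
  move=> [/esym/eqP/cards1P[w wE]].
  have fE : f y = w.
    rewrite /f; case: pickP => [z|/(_ w)]; rewrite wE inE ?eqxx //.
    by move=> /eqP.
  have : w \in pblock P y :\ y by rewrite wE inE.
  rewrite fE !inE => /andP[wy _]; split=> //.
  by rewrite -wE setD1K // mem_pblock.
have fK y : f (f y) = y.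
  have [f1 E1] := fP y; have [f2 E2] := fP (f y).
  have E : pblock P (f y) = pblock P y.
    by apply: def_pblock => //; rewrite E1 !inE eqxx orbT.
  have : y \in pblock P (f y) by rewrite E mem_pblock.
  by rewrite E2 !inE eq_sym (negPf f1) /= => /eqP.
exists (perm (can_inj fK)); split=> [y|y|]; rewrite ?permE ?fK //.
  by have [] := fP y.
have pE y : porbit (perm (can_inj fK)) y = pblock P y.
  apply/setP => z; rewrite porbit_involution; last by move=> w; rewrite !permE fK.
  by have [_ ->] := fP y; rewrite permE.
apply/setP => C; apply/idP/imsetP => [CP|[y _ ->]]; last by rewrite pE.
have /card_gt0P[y yC] : 0 < #|C| by rewrite (eqP (card2 _ CP)).
by exists y; rewrite // pE (def_pblock trivP CP yC).
Qed.

Lemma card_connected_diagrams n : #|connected_diagrams n| = nlchords n.*2.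
Proof.
have -> : connected_diagrams n = @porbits _ @: lchords [set: 'I_n.*2].
  apply/setP => P; rewrite inE; apply/andP/imsetP => [[mP cP]|[a /lchordsP C ->]].
    have [a [aK nofix E]] := matching_involution mP; exists a => //.
    rewrite E in cP; have conn := (porbits_connected aK).1 cP.
    apply/lchordsP; split=> //; first by apply/subsetP => y; rewrite inE.
    by move=> y A sA cA _ yA; rewrite (conn y A).
  split; first exact: porbits_matching.
  apply/(porbits_connected (chK C)) => y A sA cA yA; apply/eqP.
  by rewrite -subTset (ch_conn C sA cA (in_setT y) yA).
(* The involution is recovered from its orbits: [a y] is the other element of the orbit of [y]. *)
apply: card_in_imset => a b /lchordsP A /lchordsP B E; apply/permP => y.
have : porbit a y \in porbits b by rewrite -E imset_f ?inE.
case/imsetP=> z _ Ez; have : y \in porbit b z by rewrite -Ez porbit_id.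
rewrite -eq_porbit_mem -Ez => /eqP Eab.
have : a y \in porbit b y by rewrite Eab (mem_porbit a 1).
rewrite porbit_involution ?inE; last exact: chK B.
by rewrite (negPf (ch_nofix A (in_setT y))) => /eqP.
Qed.

(* A closed rooted map of size n has exactly 2n-1 half-edges
   (the root plus n-1 two-element alpha-orbits), so its iso classes are
   those of maps with half-edge set 'I_(n.*2.-1). *)
Theorem theorem1p10 (n : nat) (hn : 1 <= n) :
  num_bridgeless_classes n.*2.-1 = #|connected_diagrams n|.
Proof.
apply/eqP; rewrite -(eqn_pmul2r (fact_gt0 n.*2.-1)) -card_bridgeless_maps.
rewrite nlmaps_nlchords card_connected_diagrams mulnC prednK // double_gt0.
exact: hn.
Qed.
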